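(* Let $E,E'$ be real Banach spaces of dimension at least $2$, let $D\subsetneq E$ and $D'\subsetneq E'$ be $c$-uniform domains, let $L\ge1$, let $\varphi:[0,\infty)\to[0,\infty)$ be a homeomorphism with $\varphi(t)\ge t$ for all $t$, and let $f:\overline{D}\to\overline{D'}$ be a homeomorphism such that $f|_D$ is a $\varphi$-FQC map of $D$ onto $D'$ and $f|_{\partial D}:\partial D\to\partial D'$ is $L$-bilipschitz. If $D$ is bounded, then for all $x,y\in D$, $$\frac{|x-y|^{1/\alpha}}{C}\le|f(x)-f(y)|\le C|x-y|^{\alpha},$$ where $C\ge1$ and $\alpha\in(0,1)$ are constants depending only on $c$, $L$, $\varphi$ and $\operatorname{diam}(D)$.
   Context: The norm of $E$ or $E'$ is $|\cdot|$. A domain is a nonempty open connected set. $\dot E=E\cup\{\infty\}$ is the Hausdorff space in which the neighborhoods of $\infty$ are the complements of closed bounded sets of $E$; boundaries $\partial A$ and closures $\overline{A}$ of sets $A\subset E$ are taken in $\dot E$ (similarly for $E'$). For a domain $D\subsetneq E$, $d_D(z)$ is the norm distance from $z\in D$ to $\partial D$, and $k_D(z_1,z_2)=\inf_\alpha\int_\alpha |dz|/d_D(z)$ is the quasihyperbolic distance, the infimum being over all rectifiable arcs $\alpha$ in $D$ joining $z_1$ to $z_2$. $D$ is $c$-uniform if each pair $z_1,z_2\in D$ can be joined by a rectifiable arc $\alpha$ in $D$ with $\min_{j=1,2}\ell(\alpha[z_j,z])\le c\,d_D(z)$ for all $z\in\alpha$ and $\ell(\alpha)\le c|z_1-z_2|$,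 where $\ell$ is norm length and $\alpha[z_j,z]$ is the part of $\alpha$ between $z_j$ and $z$. A homeomorphism $f:G\to G'$ between domains is $\varphi$-solid if $k_{G'}(f(x),f(y))\le\varphi(k_G(x,y))$ for all $x,y\in G$ and $f^{-1}$ satisfies the analogous inequality. It is $\varphi$-FQC (freely $\varphi$-quasiconformal, fully $\varphi$-solid) if for every subdomain $G_1\subset G$ the map $f|_{G_1}:G_1\to f(G_1)$ is $\varphi$-solid. $f$ is $L$-bilipschitz on a set if $|x-y|/L\le|f(x)-f(y)|\le L|x-y|$ for all points $x,y$ of it. Convention on boundaries: the $L$-bilipschitz condition on $\partial D$ means that $f$ maps $\partial D\cap E$ onto $\partial D'\cap E'$ and satisfies this inequality for all $x,y\in\partial D\cap E$; in particular, $f(\infty)=\infty$ if $\infty\in\partial D$. *)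

(* Defs.v *)
From HB Require Import structures.
From mathcomp Require Import all_boot all_order all_algebra.
From mathcomp Require Import all_classical all_reals all_analysis.

Set Implicit Arguments.
Unset Strict Implicit.
Unset Printing Implicit Defensive.

Import Order.TTheory GRing.Theory Num.Theory.
Import numFieldNormedType.Exports.

Local Open Scope classical_set_scope.
Local Open Scope ring_scope.

(* The extended space E u {oo}. It differs from the one-point compactification
   of the library: the closed sets removed around oo are bounded instead of
   compact, so it is not compact when E has infinite dimension. *)
Definition ext_space (E : Type) : Type := option E.
Definition fin {E : Type} (x : E) : ext_space E := Some x.
Definition infty {E : Type} : ext_space E := None.

Section ext_topology.
Context {R : realType} {E : normedModType R}.

Local Notation eE := (ext_space E).

HB.instance Definition _ := Choice.on eE.
HB.instance Definition _ := Pointed.on eE.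

Definition ext_nbhs (p : eE) : set_system eE :=
  if p is Some x then fin @ nbhs x else
    filter_from [set B : set E | closed B /\ bounded_set B]
                (fun B => fin @` (~` B) `|` [set infty]).

Let ext_filter (p : eE) : ProperFilter (ext_nbhs p).
Proof.
case: p => [x|]; first exact: fmap_proper_filter.
apply: filter_from_proper; last by move=> ? _; exists None; right.
apply: filter_from_filter.
  by exists set0; split; [exact: closed0 | apply: nearW => M x].
move=> P Q [cP bP] [cQ bQ]; exists (P `|` Q).
- split; first exact: closedU.
  move: bP bQ; rewrite /= /bounded_near; apply: filterS2 => M MP MQ x.
  by case=> [/MP|/MQ].
- case=> [x [|//]|[] //= _]; [|by split; right..].
  by move=> [a /not_orP[Pa Qa]] [<-{x}]; split => //; left; exists a.
Qed.

Let ext_singleton (p : eE) U : ext_nbhs p U -> U p.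
Proof. by case: p => [x /= /nbhs_singleton//|[W _]]; apply; right. Qed.

Let ext_nbhs_nbhs (p : eE) (A : set eE) :
  ext_nbhs p A -> ext_nbhs p (ext_nbhs^~ A).
Proof.
case: p => [r /=|].
  rewrite nbhs_simpl nbhsE => -[U [oU Ur] USA/=].
  by exists U => //= z /=; rewrite nbhs_simpl nbhsE => Uz; exists U.
case=> C [cC bC] nCA /=; exists C => // -[|_]; last by exists C.
move=> x [|//] [y] /[swap] -[-> /=] nCx; rewrite nbhs_simpl nbhsE/=.
exists (~` C); first by split => //; exact: closed_openC.
by move=> z /= nCz; apply: nCA; left; exists z.
Qed.

HB.instance Definition _ := hasNbhs.Build eE ext_nbhs.

HB.instance Definition _ := @Nbhs_isNbhsTopological.Build eE
  ext_filter ext_singleton ext_nbhs_nbhs.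

Lemma ext_hausdorff : hausdorff_space eE.
Proof.
have inftyP (x : E) : ~ cluster (nbhs (fin x : eE)) infty.
  move=> /(_ (fin @` closed_ball x 1)
             (fin @` (~` closed_ball x 1) `|` [set infty])).
  have nx : nbhs (fin x : eE) (fin @` closed_ball x 1).
    apply: (@filterS _ (nbhs x) _ (closed_ball x 1)); first by move=> y; exists y.
    exact: filterS (@subset_closed_ball _ _ x 1) (nbhsx_ballx x 1 ltr01).
  have ninf : nbhs (infty : eE) (fin @` (~` closed_ball x 1) `|` [set infty]).
    exists (closed_ball x 1) => //; split; first exact: closed_ball_closed.
    exists (1 + `|x|); split=> [|M /ltW xM y /=]; first exact: num_real.
    rewrite closed_ballE//= /closed_ball_ /= => xy; apply: le_trans xM.
    by rewrite -[y](subrK x) (le_trans (ler_normD _ _))// lerD2r distrC.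
  by move=> /(_ nx ninf) [p [[y xy <-]]] [[z xz []]|//] => zy; apply: xz; rewrite zy.
move=> [x|] [y|] //.
- move=> xy; congr Some; apply: norm_hausdorff => A B nA nB.
  have [] := xy (fin @` A) (fin @` B).
  - by apply: (@filterS _ (nbhs x) _ A) => // z; exists z.
  - by apply: (@filterS _ (nbhs y) _ B) => // z; exists z.
  by move=> p [[a Aa <-] [b Bb [ba]]]; exists a; split=> //; rewrite -ba.
- by move=> /inftyP.
- move=> xy; exfalso; apply: (inftyP y) => A B nA nB.
  by rewrite setIC; exact: xy.
Qed.

End ext_topology.

Definition boundary (X : topologicalType) (A : set X) : set X :=
  closure A `\` interior A.

(* The values of f outside of A and of g outside of B are irrelevant. *)
Definition homeo_inv (X Y : topologicalType) (A : set X) (B : set Y)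
    (f : X -> Y) (g : Y -> X) : Prop :=
  [/\ set_bij A B f, {within A, continuous f}, {within B, continuous g}
    & {in A, cancel f g}].

Definition homeo (X Y : topologicalType) (A : set X) (B : set Y)
    (f : X -> Y) : Prop :=
  exists g : Y -> X, homeo_inv A B f g.

(* The finite part of a map of extended spaces; it only carries information at
   the points x such that f (fin x) is finite. *)
Definition fin_part (R : realType) (E E' : normedModType R)
    (f : ext_space E -> ext_space E') (x : E) : E' :=
  if f (fin x) is Some y then y else 0.

Section normed.
Context {R : realType} {E : normedModType R}.
Implicit Types (D : set E) (a b : R) (g : R -> E).

Definition dim_ge2 : Prop :=
  exists u v : E, forall s t : R, s *: u + t *: v = 0 -> s = 0 /\ t = 0.

Definition domain D : Prop := [/\ D !=set0, open D & connected D].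

Definition proper_domain D : Prop := domain D /\ D <> setT.

Definition ext_boundary D : set (ext_space E) := boundary (fin @` D).

Definition diam D : R := sup [set `|x - y| | x in D & y in D].

(* Only the finite boundary points matter, oo being infinitely far. *)
Definition bdist D (z : E) : R :=
  inf [set `|z - w| | w in [set w | ext_boundary D (fin w)]].

(* The case a = b is allowed: a point is an arc joining it to itself. *)
Definition is_arc a b g : Prop :=
  [/\ a <= b, {within `[a, b], continuous g} & set_inj `[a, b] g].

Definition arc_joins_in D (z1 z2 : E) a b g : Prop :=
  [/\ is_arc a b g, g a = z1, g b = z2 & g @` `[a, b] `<=` D].

Definition polygon_length a b g (s : seq R) : R :=
  let F := g \o nth b (a :: s) in
  \sum_(0 <= n < size s) `|F n.+1 - F n|.

Definition arc_length a b g : \bar R :=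
  ereal_sup [set (polygon_length a b g s)%:E | s in itv_partition a b].

(* The point at length t along g from g a: the arclength parametrization,
   defined for 0 <= t <= arc_length a b g when the arc is rectifiable. *)
Definition arclength_param a b g (t : R) : E :=
  g (xget a [set u | u \in `[a, b] /\ arc_length a u g = t%:E]).

Definition line_integral (rho : E -> R) a b g : \bar R :=
  (\int[lebesgue_measure]_(t in `[0%R, fine (arc_length a b g)]%classic)
     (rho (arclength_param a b g t))%:E)%E.

(* The infimum is finite for a proper domain D and z1, z2 in D. *)
Definition qhdist D (z1 z2 : E) : R :=
  fine (ereal_inf [set r | exists a b g,
    [/\ arc_joins_in D z1 z2 a b g, (arc_length a b g < +oo)%E
      & r = line_integral (fun z => (bdist D z)^-1) a b g]]).

Definition uniform_domain (c : R) D : Prop :=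
  proper_domain D /\
  forall z1 z2, D z1 -> D z2 -> exists a b g,
    [/\ arc_joins_in D z1 z2 a b g, (arc_length a b g < +oo)%E,
        forall t, t \in `[a, b] ->
          (Order.min (arc_length a t g) (arc_length t b g)
             <= (c * bdist D (g t))%:E)%E
      & (arc_length a b g <= (c * `|z1 - z2|)%:E)%E].

End normed.

Arguments dim_ge2 {R} E.

Section maps.
Context {R : realType} {E E' : normedModType R}.
Implicit Types (G : set E) (H : set E').

Definition solid (phi : R -> R) G H (f : E -> E') : Prop :=
  [/\ proper_domain G, proper_domain H
    & exists g : E' -> E,
      [/\ homeo_inv G H f g,
          forall x y, G x -> G y ->
            qhdist H (f x) (f y) <= phi (qhdist G x y)
        & forall x y, H x -> H y ->
            qhdist G (g x) (g y) <= phi (qhdist H x y)]].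

Definition FQC (phi : R -> R) G H (f : E -> E') : Prop :=
  [/\ domain G, domain H, homeo G H f
    & forall G1, domain G1 -> G1 `<=` G -> solid phi G1 (f @` G1) f].

Definition bilipschitz_on (L : R) (A : set E) (f : E -> E') : Prop :=
  forall x y, A x -> A y ->
    `|x - y| / L <= `|f x - f y| /\ `|f x - f y| <= L * `|x - y|.

Definition boundary_bilipschitz (L : R) G H
    (f : ext_space E -> ext_space E') : Prop :=
  f @` (ext_boundary G `&` range fin) = ext_boundary H `&` range fin /\
  bilipschitz_on L [set x | ext_boundary G (fin x)] (fin_part f).

End maps.

(* Main.v *)
Require Import Defs.
From HB Require Import structures.
From mathcomp Require Import all_boot all_order all_algebra.
From mathcomp Require Import all_classical all_reals all_analysis.
From mathcomp Require Import ring lra.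

Set Implicit Arguments.
Unset Strict Implicit.
Unset Printing Implicit Defensive.

Import Order.TTheory GRing.Theory Num.Theory.
Import numFieldNormedType.Exports.

Local Open Scope classical_set_scope.
Local Open Scope ring_scope.

(** The only quasihyperbolic distances that matter are the small ones: solidity
    of [f] and of its inverse says that points whose distance is a small multiple
    of the distance d to the boundary are sent to points of the same kind. Along
    the two halves of a uniform arc, points at successive distances d / 4 make
    "d at the starting point + length" grow geometrically. Hence the j-distance of
    two points of D' controls, up to an affine change, that of their preimages.
    Let z' be a centre of D' and q its preimage. The height d'(f x) is at most
    C (d(x) d(q))^a for x away from q, and summing over a uniform arc between two
    boundary points far from q bounds the distance of their images by C d(q)^a.
    The boundary condition then forces q to be a centre of D, so that
    d'(f x) <= C d(x)^a for all x, and a second summation gives the Hölder estimate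
    for points that are far apart relative to their distance to the boundary. For
    the other pairs, free quasiconformality in a punctured ball gives a local
    Hölder estimate. The lower bound is the upper bound for the inverse. *)

(** The constants are fixed before the spaces and the domains, so every estimate has to be
    quantitative in c, L, [phi] and the diameter. Solidity at the scale of d bounds the effect of
    one step by a factor [M], but gives no rate of decay at a point x. Deleting x supplies the rate:
    near x the distance to the boundary of the punctured domain is the distance to x, so the same
    factor [M] is available at every scale around x. This is where dimension at least 2 enters:
    punctured balls are connected, and two points can be joined by two segments that keep away from
    the puncture. The global exponent compares two geometric rates. Along half of a uniform arc the
    potential grows by the ratio 1 + 1 / (4 (1 + 2 c)) per step, each step costs a factor [M], and
    [B] is chosen so that the power [B] of the ratio is at least [M]. To use one estimate for the
    map and its inverse, both domains must satisfy the same bounds; for D' this requires controlling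
    the diameter from above and from below by means of the boundary values alone. *)

Lemma within_continuousP (R : realType) (T U : pseudoMetricNormedZmodType R)
    (A : set T) (g : T -> U) :
  {within A, continuous g} <->
  forall t, A t -> forall e : R, 0 < e ->
    exists2 d : R, 0 < d & forall s, A s -> `|t - s| < d -> `|g t - g s| < e.
Proof.
rewrite subspace_continuousP; split => h t At.
  move=> e e0; have /cvgrPdist_lt /(_ e e0) := h t At.
  rewrite /= near_withinE near_nbhs => /nbhs_ballP[d /= d0 H].
  by exists d => // s As ts; apply: H => //; rewrite -ball_normE.
apply/cvgrPdist_lt => e e0; rewrite near_withinE near_nbhs.
have [d d0 H] := h t At e e0; apply/nbhs_ballP; exists d => //= s.
by rewrite -ball_normE /= => ts As; exact: H.
Qed.

(** * Distance to the boundary *)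

Section boundary_distance.
Context {R : realType} {E : normedModType R}.
Implicit Types (D : set E).

Lemma closure_fin D w : closure (fin @` D) (fin w : ext_space E) <-> closure D w.
Proof.
split=> H B nB.
  have [] := H (fin @` B); first by apply: (@filterS _ (nbhs w) _ B) => // z; exists z.
  by move=> p [[x Dx <-] [y By [yx]]]; exists x; split=> //; rewrite -yx.
have [x [Dx Bx]] := H _ nB.
by exists (fin x); split => //; exists x.
Qed.

Lemma ext_boundary_fin D w :
  open D -> ext_boundary D (fin w) <-> closure D w /\ ~ D w.
Proof.
move=> oD.
have intE : interior (fin @` D) (fin w : ext_space E) <-> D w.
  split=> [/interior_subset[x Dx [<-]]//|Dw].
  apply: (@filterS _ (nbhs w) _ D) => [z|]; first by exists z.
  exact: open_nbhs_nbhs.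
by split => -[h1 h2]; split;
  [exact/closure_fin|by move/intE|exact/closure_fin|by move/intE].
Qed.

Lemma open_ballP D z : open D -> D z ->
  exists2 r : R, 0 < r & forall w, `|z - w| < r -> D w.
Proof.
move=> oD Dz; have /nbhs_ballP[r /= r0 H] : nbhs z D by exact: open_nbhs_nbhs.
by exists r => // w zw; apply: H; rewrite -ball_normE.
Qed.

Lemma not_closure_ballP D z : ~ closure D z ->
  exists2 r : R, 0 < r & forall w, `|z - w| < r -> ~ D w.
Proof.
move=> nz; have : nbhs z (~` closure D).
  by apply: open_nbhs_nbhs; split => //; exact/closed_openC/closed_closure.
move=> /nbhs_ballP[r /= r0 H]; exists r => // w zw Dw.
by have := H w; rewrite -ball_normE /= => /(_ zw); apply; exact: subset_closure.
Qed.

Lemma closure_normP D z : closure D z <->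
  forall e : R, 0 < e -> exists2 w, D w & `|z - w| < e.
Proof.
split=> [cz e e0|H].
  by have [w [Dw]] := cz _ (nbhsx_ballx z e e0); rewrite -ball_normE; exists w.
apply: contrapT => /not_closure_ballP[r r0 Hr].
by have [w Dw zw] := H r r0; exact: (Hr w).
Qed.

Lemma first_hit (g : R -> E) a b (S : set E) :
  a <= b -> {within `[a, b], continuous g} -> closed S -> S (g b) ->
  exists2 t, t \in `[a, b] & S (g t) /\ forall s, a <= s < t -> ~ S (g s).
Proof.
move=> ab cg cS Sb.
pose K := [set t | t \in `[a, b] /\ S (g t)].
have hK : has_inf K.
  split; first by exists b; split => //; rewrite in_itv /= ab lexx.
  by exists a => t [/itvP ht _]; rewrite ht.
have Kb : K b by split => //; rewrite in_itv /= ab lexx.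
set t := inf K.
have ta : a <= t by apply: lb_le_inf; [exact: hK.1|move=> s [/itvP hs _]; rewrite hs].
have tb : t <= b by exact: ge_inf hK.2 _ Kb.
have tab : t \in `[a, b] by rewrite in_itv /= ta tb.
exists t => //; split.
  apply: contrapT => nSt.
  have [e e0 He] := open_ballP (closed_openC cS) nSt.
  have [d d0 Hd] := (within_continuousP _ _).1 cg t tab e e0.
  have [s [Hs Ss] st] := inf_adherent d0 hK.
  have ts : t <= s by exact: ge_inf hK.2 _ (conj Hs Ss).
  apply: (He (g s)) => //; apply: Hd => //.
  by rewrite distrC ger0_norm ?subr_ge0// ltrBlDl.
move=> s /andP[as_ st] Ss.
have : t <= s.
  apply: ge_inf hK.2 _ _; split => //.
  by rewrite in_itv /= as_ (le_trans (ltW st) tb).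
by rewrite leNgt st.
Qed.

Lemma lipschitz_within (A : set R) (g : R -> E) (K : R) :
  (forall s t, A s -> A t -> `|g s - g t| <= K * `|s - t|) ->
  {within A, continuous g}.
Proof.
move=> gK; apply/within_continuousP => t At e e0.
have K1 : 0 < `|K| + 1 by rewrite ltr_wpDl.
exists (e / (`|K| + 1)) => [|s As ts]; first by rewrite divr_gt0.
apply: le_lt_trans (gK _ _ At As) _.
apply: (@le_lt_trans _ _ ((`|K| + 1) * `|t - s|)).
  by rewrite ler_wpM2r// (le_trans (ler_norm _))// lerDl.
by rewrite mulrC -ltr_pdivlMr.
Qed.

Lemma segment_lipschitz (x v : E) (s t : R) :
  `|(x + s *: v) - (x + t *: v)| = `|v| * `|s - t|.
Proof. by rewrite opprD addrACA subrr add0r -scalerBl normrZ mulrC. Qed.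

Lemma segment_boundary D x v : open D -> D x -> ~ D (x + v) ->
  exists t, [/\ 0 <= t <= 1, closure D (x + t *: v), ~ D (x + t *: v)
    & forall s, 0 <= s < t -> D (x + s *: v)].
Proof.
move=> oD Dx nDv.
have cg : {within `[0, 1], continuous (fun t : R => x + t *: v)}.
  by apply: (@lipschitz_within _ _ `|v|) => s t _ _; rewrite segment_lipschitz.
have [|t] := first_hit ler01 cg (open_closedC oD); first by rewrite scale1r.
rewrite in_itv /= => t01 [nDt Hs]; exists t; split => //; last first.
  by move=> s /Hs /contrapT.
have [t0|t0] := eqVneq t 0.
  by move: nDt; rewrite t0 scale0r addr0.
have {}t0 : 0 < t by rewrite lt_neqAle eq_sym t0; case/andP: t01.
apply/closure_normP => e e0.
pose s := Num.max 0 (t - e / (`|v| + 1)).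
have v1 : 0 < `|v| + 1 by rewrite ltr_wpDl.
have st : 0 <= s < t.
  by rewrite le_max lexx /= gt_max t0 /= ltrBlDr ltrDl divr_gt0.
exists (x + s *: v); first by apply: contrapT; exact: Hs.
rewrite segment_lipschitz.
have : `|t - s| <= e / (`|v| + 1).
  case/andP: st => _ st; rewrite ger0_norm; last by rewrite subr_ge0 ltW.
  by rewrite lerBlDr addrC -lerBlDr le_max lexx orbT.
rewrite ler_pdivlMr// => h.
have : 0 <= `|t - s| by [].
have [->|ts] := eqVneq (`|t - s|) 0; first by rewrite mulr0.
move=> /[!le0r] /orP[/eqP h0|]; first by rewrite h0 eqxx in ts.
by move=> tsp; apply: lt_le_trans h; rewrite mulrDr mulr1 mulrC ltrDl.
Qed.

Lemma ext_boundary_neq0 D : proper_domain D ->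
  exists w, ext_boundary D (fin w).
Proof.
move=> [[[x Dx] oD _] /eqP nT]; have [y nDy] : exists y, ~ D y.
  apply: contra_notP (elimN eqP nT) => /forallNP h.
  by apply/seteqP; split=> // y _; apply: contrapT.
have [|t [_ ct nt _]] := @segment_boundary D x (y - x) oD Dx.
  by rewrite addrC subrK.
by exists (x + t *: (y - x)); apply/ext_boundary_fin.
Qed.

Lemma bdist_has_inf D z : proper_domain D ->
  has_inf [set `|z - w| | w in [set w | ext_boundary D (fin w)]].
Proof.
move=> /ext_boundary_neq0[w Dw]; split; first by exists `|z - w|, w.
by exists 0 => _ [v _ <-].
Qed.

Lemma bdist_le D z w : proper_domain D -> closure D w -> ~ D w ->
  bdist D z <= `|z - w|.
Proof.
move=> pD cw nw; apply: ge_inf (bdist_has_inf z pD).2 _ _.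
by exists w => //; apply/ext_boundary_fin => //; case: pD => -[].
Qed.

Lemma le_bdist D z (r : R) : proper_domain D ->
  (forall w, closure D w -> ~ D w -> r <= `|z - w|) -> r <= bdist D z.
Proof.
move=> pD H; apply: lb_le_inf (bdist_has_inf z pD).1 _ => _ [w /= Dw <-].
have [] := (ext_boundary_fin w _).1 Dw; first by case: pD => -[].
exact: H.
Qed.

Lemma le_bdist_ball D z (r : R) : proper_domain D ->
  (forall w, `|z - w| < r -> D w) -> r <= bdist D z.
Proof.
move=> pD H; apply: le_bdist => // w _ nDw; rewrite leNgt.
by apply/negP => /H.
Qed.

Lemma bdist_gt0 D z : proper_domain D -> D z -> 0 < bdist D z.
Proof.
move=> pD Dz; have [r r0 H] := open_ballP (let: And3 _ h _ := pD.1 in h) Dz.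
exact: lt_le_trans r0 (le_bdist_ball pD H).
Qed.

Lemma bdist_lip D z w : proper_domain D -> bdist D z <= bdist D w + `|z - w|.
Proof.
move=> pD; rewrite -lerBlDr; apply: le_bdist => // v cv nv.
rewrite lerBlDr; apply: le_trans (bdist_le z pD cv nv) _.
by rewrite [leRHS]addrC ler_distD.
Qed.

Lemma bdist_ball D z w : proper_domain D -> D z -> `|z - w| < bdist D z -> D w.
Proof.
move=> pD Dz zw; apply: contrapT => nDw.
have [|t [/andP[t0 t1] ct nt _]] :=
    @segment_boundary D z (w - z) (let: And3 _ h _ := pD.1 in h) Dz.
  by rewrite addrC subrK.
have := bdist_le z pD ct nt; rewrite opprD addrA subrr add0r normrN normrZ.
rewrite leNgt => /negP; apply; rewrite distrC in zw.
by apply: le_lt_trans zw; rewrite ger0_norm// ler_piMl.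
Qed.

End boundary_distance.

(** * Arcs and the quasihyperbolic distance *)

Section arc_length.
Context {R : realType} {E : normedModType R}.
Implicit Types (a b t u : R) (g : R -> E) (s : seq R).

Lemma polygon_length_nil a b g : polygon_length a b g [::] = 0.
Proof. by rewrite /polygon_length big_geq. Qed.

Lemma polygon_length_cons a b g x s :
  polygon_length a b g (x :: s) = `|g x - g a| + polygon_length x b g s.
Proof. by rewrite /polygon_length /= big_nat_recl. Qed.

Lemma polygon_length_rcons a b c g s x :
  polygon_length a b g (rcons s x) =
  polygon_length a c g s + `|g x - g (last a s)|.
Proof.
elim: s a => [|y s ih] a /=.
  by rewrite polygon_length_cons !polygon_length_nil add0r addr0.
by rewrite !polygon_length_cons ih addrA.
Qed.

Lemma dist_arc_length a b g :
  a <= b -> (`|g b - g a|%:E <= arc_length a b g)%E.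
Proof.
rewrite le_eqVlt => /predU1P[<-|ab].
  apply: ereal_sup_ubound; exists [::]; first by split => /=.
  by rewrite polygon_length_nil subrr normr0.
apply: ereal_sup_ubound; exists [:: b]; first exact: itv_partition1.
by rewrite polygon_length_cons polygon_length_nil addr0.
Qed.

Lemma arc_length_ge0 a b g : a <= b -> (0 <= arc_length a b g)%E.
Proof. by move=> /(dist_arc_length g); apply: le_trans; rewrite lee_fin. Qed.

(** Any polygon inscribed up to [t] extends by one chord. Together with its mirror image below, this
    is the part of additivity that makes length dominate distance along an arc. *)
Lemma arc_length_prefix a t u g : a <= t -> t <= u ->
  (arc_length a t g + `|g u - g t|%:E <= arc_length a u g)%E.
Proof.
move=> at_; rewrite le_eqVlt => /predU1P[<-|tu].
  by rewrite subrr normr0 adde0.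
rewrite -leeBrDr//; apply: ge_ereal_sup => _ [s [ps ls] <-].
rewrite leeBrDr// -EFinD; apply: ereal_sup_ubound.
exists (rcons s u); last by rewrite (polygon_length_rcons _ _ t) (eqP ls).
by split; rewrite ?rcons_path ?last_rcons// ps (eqP ls).
Qed.

Lemma arc_length_suffix t u b g : t <= u -> u <= b ->
  (`|g u - g t|%:E + arc_length u b g <= arc_length t b g)%E.
Proof.
rewrite le_eqVlt => /predU1P[<-|tu] ub.
  by rewrite subrr normr0 add0e.
rewrite addeC -leeBrDr//; apply: ge_ereal_sup => _ [s [ps ls] <-].
rewrite leeBrDr// -EFinD; apply: ereal_sup_ubound.
exists (u :: s); last by rewrite polygon_length_cons addrC.
by split => //=; rewrite tu.
Qed.

Lemma arc_length_lipschitz a b g (K : R) : a <= b ->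
  (forall r t, r \in `[a, b] -> t \in `[a, b] -> `|g r - g t| <= K * `|r - t|) ->
  (arc_length a b g <= (K * (b - a))%:E)%E.
Proof.
move=> ab gK; apply: ge_ereal_sup => _ [s ps <-]; rewrite lee_fin.
elim: s a ab gK ps => [|x s ih] a ab gK ps.
  by rewrite polygon_length_nil (itv_partition_nil ps) subrr mulr0.
have px := itv_partition_cons ps.
have xb := itv_partition_le px; move: ps => [/= /andP[ax _] _].
rewrite polygon_length_cons (_ : K * (b - a) = K * `|x - a| + K * (b - x)).
  apply: lerD; first by apply: gK; rewrite in_itv /= ?lexx ?ab// (ltW ax).
  apply: ih => // r t /itvP hr /itvP ht; apply: gK;
    by rewrite in_itv /= ?hr ?ht (le_trans (ltW ax))// ?hr ?ht.
by rewrite ger0_norm ?subr_ge0 ?(ltW ax)//; ring.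
Qed.

(** If no parameter has length exactly [t], the default value [a] yields [g a], at distance 0 from
    the start, so the bound holds for every nonnegative [t]. *)
Lemma arclength_param_itv a b g t : a <= b -> 0 <= t ->
  exists2 u, u \in `[a, b] &
    arclength_param a b g t = g u /\ `|g u - g a| <= t.
Proof.
move=> ab t0; rewrite /arclength_param.
case: xgetP => [u _ [hu lu]|_].
  exists u => //; split => //; rewrite -lee_fin -lu.
  by apply: dist_arc_length; rewrite (itvP hu).
by exists a; rewrite ?in_itv /= ?lexx// subrr normr0.
Qed.

End arc_length.

(* No measurability is required, the integral of a nonnegative function being
   the supremum of those of the simple functions below it. *)
Lemma ge0_integral_mono d (T : measurableType d) (R : realType)
    (mu : {measure set T -> \bar R}) (D : set T) (f1 f2 : T -> \bar R) :
  (forall x, D x -> 0 <= f1 x)%E -> (forall x, D x -> f1 x <= f2 x)%E ->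
  (\int[mu]_(x in D) f1 x <= \int[mu]_(x in D) f2 x)%E.
Proof.
move=> f10 f12; rewrite !ge0_integralE//; last first.
  by move=> x Dx; exact: le_trans (f10 x Dx) (f12 x Dx).
apply: ge_ereal_sup => _ [h hf <-]; apply: ereal_sup_ubound; exists h => // x.
by apply: le_trans (hf x) _; rewrite /patch; case: ifPn => // /set_mem; exact: f12.
Qed.

Lemma integral_inv_shift (R : realType) (d l : R) : 0 < d -> 0 <= l ->
  (\int[lebesgue_measure]_(t in `[0%R, l]%classic) ((d + t)^-1)%:E =
   (ln (1 + l / d))%:E)%E.
Proof.
move=> d0; rewrite le_eqVlt => /predU1P[<-|l0].
  by rewrite set_itv1 integral_set1 mul0r addr0 ln1.
have pos (t : R) : 0 <= t -> 0 < d + t by move=> ?; rewrite ltr_pwDl.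
have dF (t : R) : 0 <= t -> is_derive t 1 (fun t : R => ln (d + t)) ((d + t)^-1).
  move=> t0; have p := pos _ t0.
  have : is_derive (d + t) 1 (@ln R) (d + t)^-1 by exact: is_derive1_ln.
  move=> h.
  have := @is_derive1_comp _ (@ln R) (fun t => d + t) t (d + t)^-1 1 h _.
  rewrite mulr1; apply.
  by rewrite -[X in is_derive _ _ _ X]add0r; apply: is_deriveD.
have cF (t : R) : 0 <= t -> {for t, continuous (fun t : R => ln (d + t))}.
  by move=> t0; apply/differentiable_continuous/derivable1_diffP; have [] := dF t t0.
rewrite (@continuous_FTC2 _ _ (fun t => ln (d + t)))//.
- rewrite addr0 -EFinB -ln_div ?posrE//; last by rewrite ltr_wpDr// ltW.
  by rewrite mulrDl divff ?gt_eqF.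
- apply/subspace_continuousP => t /=; rewrite in_itv /= => /andP[t0 _].
  apply: cvg_within_filter; apply: cvgV; first by rewrite gt_eqF ?pos.
  by apply: cvgD; [exact: cvg_cst|exact: cvg_id].
- split.
  + by move=> t; rewrite in_itv /= => /andP[/ltW t0 _]; have [] := dF t t0.
  + by apply: cvg_at_right_filter; exact: cF.
  + by apply: cvg_at_left_filter; apply: cF; exact: ltW.
- move=> t; rewrite in_itv /= => /andP[/ltW t0 _].
  by rewrite derive1E; have [_ ->] := dF t t0.
Qed.

Section line_integral.
Context {R : realType} {E : normedModType R}.
Implicit Types (a b : R) (g : R -> E) (rho : E -> R).

Lemma line_integral_le rho a b g k : a <= b -> (arc_length a b g < +oo)%E ->
  (forall u, u \in `[a, b] -> 0 <= rho (g u) <= k) ->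
  (line_integral rho a b g <= (k * fine (arc_length a b g))%:E)%E.
Proof.
move=> ab lfin H; have l0 := arc_length_ge0 g ab.
have [l le_] : exists l, arc_length a b g = l%:E.
  by exists (fine (arc_length a b g)); rewrite fineK// ge0_fin_numE.
rewrite /line_integral le_ /=; have {}l0 : 0 <= l by rewrite le_ lee_fin in l0.
apply: (@le_trans _ _ (\int[lebesgue_measure]_(t in `[0%R, l]%classic) cst (k%:E) t)%E).
  by apply: ge0_integral_mono => t /=; rewrite in_itv /= => /andP[t0 _];
    have [u hu [-> _]] := arclength_param_itv g ab t0;
    rewrite lee_fin; case/andP: (H u hu).
rewrite integral_cst//= lebesgue_measure_itv /= lte_fin.
case: ltP => h /=; first by rewrite -EFinB subr0 -EFinM.
by rewrite (_ : l = 0) ?mulr0 ?mule0//; apply/le_anti; rewrite h.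
Qed.

(** The point at length t is within t of [g a], so the density there is at least 1 / (d + t), whose
    integral over the length l is ln (1 + l / d); finally l is at least the chord. *)
Lemma line_integral_ge rho a b g d : a <= b -> (arc_length a b g < +oo)%E ->
  0 < d -> (forall u, u \in `[a, b] -> (d + `|g u - g a|)^-1 <= rho (g u)) ->
  ((ln (1 + `|g b - g a| / d))%:E <= line_integral rho a b g)%E.
Proof.
move=> ab lfin d0 H; have l0 := arc_length_ge0 g ab.
have [l le_] : exists l, arc_length a b g = l%:E.
  by exists (fine (arc_length a b g)); rewrite fineK// ge0_fin_numE.
have dl := dist_arc_length g ab.
rewrite /line_integral le_ /=; have {}l0 : 0 <= l by rewrite le_ lee_fin in l0.
rewrite le_ lee_fin in dl.
apply: (@le_trans _ _ (ln (1 + l / d))%:E).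
  rewrite lee_fin ler_ln ?posrE; last 2 first.
  - by rewrite ltr_pwDl// divr_ge0// ltW.
  - by rewrite ltr_pwDl// divr_ge0// ltW.
  by rewrite lerD2l ler_pM2r// invr_gt0.
rewrite -integral_inv_shift//; apply: ge0_integral_mono => t /=;
  rewrite in_itv /= => /andP[t0 _].
  by rewrite lee_fin invr_ge0 ltW// ltr_pwDl.
have [u hu [-> hd]] := arclength_param_itv g ab t0.
rewrite lee_fin; apply: le_trans (H u hu).
by rewrite lef_pV2 ?posrE ?lerD2l// ltr_pwDl.
Qed.

End line_integral.

Section quasihyperbolic.
Context {R : realType} {E : normedModType R}.
Implicit Types (D : set E) (x y z : E).

(** A form of rectifiable connectedness, used to show that the infimum defining [qhdist] is
    finite. *)
Definition lipschitz_arc D z1 z2 : Prop := exists a b g (K : R),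
  arc_joins_in D z1 z2 a b g /\
  forall s t, s \in `[a, b] -> t \in `[a, b] -> `|g s - g t| <= K * `|s - t|.

Lemma lipschitz_arc_refl D x : D x -> lipschitz_arc D x x.
Proof.
move=> Dx; exists 0, 0, (cst x), 0; split; last by move=> s t _ _; rewrite subrr normr0 mul0r.
split => //; last by move=> _ [t _ <-].
split => //; first by apply: (@lipschitz_within _ _ _ _ 0) => s t _ _; rewrite subrr normr0 mul0r.
by move=> s t; rewrite set_itv1 !inE => -> ->.
Qed.

Lemma closed_segment x v : closed ((fun t : R => x + t *: v) @` `[0, 1]).
Proof.
apply: compact_closed; first exact: norm_hausdorff.
apply: continuous_compact; last exact: segment_compact.
by apply: (@lipschitz_within _ _ _ _ `|v|) => s t _ _; rewrite segment_lipschitz.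
Qed.

(** Appending the segment from y to z could destroy injectivity. The arc is therefore followed only
    up to its first point on that segment, and the segment from there to z. *)
Lemma lipschitz_arc_extend D x y z : lipschitz_arc D x y ->
  (forall t : R, 0 <= t <= 1 -> D (z + t *: (y - z))) -> lipschitz_arc D x z.
Proof.
move=> [a [b [g [K [[[ab cg ig] ga gb gD] lg]]]]] Dseg.
set S := (fun t : R => z + t *: (y - z)) @` `[0, 1].
have SD p : S p -> D p.
  by move=> [t /= ht <-]; apply: Dseg; rewrite in_itv /= in ht.
have [|t0 t0ab [[tau /= tau01 g0E] before]] :=
    first_hit ab cg (closed_segment (x := z) (v := y - z)).
  by exists 1; rewrite /= ?in_itv /= ?ler01 ?lexx// scale1r gb addrC subrK.
have /andP[tau0 tau1] : 0 <= tau <= 1 by rewrite in_itv /= in tau01.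
have [at0 t0b] : a <= t0 /\ t0 <= b by rewrite !(itvP t0ab).
have sub s : s \in `[a, t0] -> s \in `[a, b].
  by move=> /itvP hs; rewrite in_itv /= !hs (le_trans _ t0b)// hs.
pose v := z - g t0.
have vE : v = - tau *: (y - z) by rewrite /v -g0E opprD addrA subrr add0r scaleNr.
(* If the first meeting point is z itself, truncating the arc is enough; otherwise the added piece
   is a nondegenerate segment. *)
have [v0|v0] := eqVneq v 0.
  exists a, t0, g, K; split; last by move=> s t /sub hs /sub ht; exact: lg.
  split => //; last by move=> _ [s /sub hs <-]; apply: gD; exists s.
  - split => //.
      by apply: (@lipschitz_within _ _ _ _ K) => s t /sub hs /sub ht; exact: lg.
    by move=> s t; rewrite !inE => /sub hs /sub ht; apply: ig; rewrite inE.
  - by apply/esym/eqP; rewrite -subr_eq0; exact/eqP.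
pose h s := if s <= t0 then g s else g t0 + (s - t0) *: v.
have hS s : t0 <= s <= t0 + 1 -> S (g t0 + (s - t0) *: v).
  move=> /andP[s0 s1]; exists (tau * (1 - (s - t0))).
    have ? : 0 <= 1 - (s - t0) by lra.
    by rewrite /= in_itv /= mulr_ge0// mulr_ile1//; lra.
  rewrite -g0E vE scalerA -addrA -scalerDl; congr (_ + _ *: _); ring.
have hlip s t : a <= s -> s <= t -> t <= t0 + 1 ->
    `|h s - h t| <= (`|K| + `|v|) * `|s - t|.
  move=> as_ st t1; rewrite /h.
  have lg' r u : a <= r -> r <= u -> u <= t0 -> `|g r - g u| <= `|K| * `|r - u|.
    move=> ar ru ut; apply: (@le_trans _ _ (K * `|r - u|)).
      by apply: lg; apply: sub; rewrite in_itv /= ?ar ?(le_trans ar ru)// (le_trans ru).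
    by rewrite ler_wpM2r// ler_norm.
  have := normr_ge0 v; have := normr_ge0 K; have := normr_ge0 (s - t) => ? ? ?.
  have [tt0|tt0] := leP t t0.
    by rewrite (le_trans st tt0); apply: le_trans (lg' _ _ as_ st tt0) _; nra.
  have [st0|st0] := leP s t0; last first.
    rewrite segment_lipschitz (_ : s - t0 - (t - t0) = s - t); first by nra.
    by ring.
  rewrite opprD addrA; apply: le_trans (ler_normB _ _) _.
  have -> : `|s - t| = `|s - t0| + (t - t0).
    by rewrite ler0_norm ?subr_le0// ler0_norm ?subr_le0//; ring.
  rewrite normrZ (ger0_norm (x := t - t0)); last by rewrite subr_ge0 ltW.
  have := lg' _ _ as_ st0 (lexx _).
  have : 0 <= t - t0 by rewrite subr_ge0 ltW.
  have := normr_ge0 (s - t0) => ? ? ?.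
  nra.
have hlip2 s t : s \in `[a, t0 + 1] -> t \in `[a, t0 + 1] ->
    `|h s - h t| <= (`|K| + `|v|) * `|s - t|.
  move=> /itvP hs /itvP ht; have [st|/ltW ts] := leP s t.
    by apply: hlip; rewrite ?hs ?ht.
  by rewrite distrC (distrC s); apply: hlip; rewrite ?hs ?ht.
have inj s t : a <= s -> s <= t -> t <= t0 + 1 -> h s = h t -> s = t.
  move=> as_ st t1; rewrite /h; have [tt0|tt0] := leP t t0.
    rewrite (le_trans st tt0) => gst; apply: ig => //; rewrite inE /= in_itv /=.
      by rewrite as_ (le_trans st) // (le_trans tt0).
    by rewrite (le_trans as_ st) (le_trans tt0).
  have [st0|st0] := leP s t0; last first.
    move=> /addrI /eqP; rewrite -subr_eq0 -scalerBl scaler_eq0 (negbTE v0) orbF.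
    by rewrite opprB addrA subrK subr_eq0 => /eqP.
  have [->|st0'] := eqVneq s t0.
    move=> /esym/eqP; rewrite -subr_eq0 [_ + _ - _]addrAC subrr add0r scaler_eq0 (negbTE v0) orbF.
    by rewrite subr_eq0 => /eqP.
  move=> gs; exfalso; apply: (before s); first by rewrite as_ lt_neqAle st0'.
  by rewrite gs; apply: hS; rewrite (ltW tt0).
exists a, (t0 + 1), h, (`|K| + `|v|); split => //; split.
- split; first by rewrite (le_trans at0)// lerDl.
    by apply: lipschitz_within => s t hs ht; exact: hlip2.
  move=> s t; rewrite !inE /= !in_itv /= => /andP[s0 s1] /andP[r0 r1] hst.
  have [st|/ltW ts] := leP s t; first exact: inj.
  by apply/esym; apply: inj.
- by rewrite /h at0.
- by rewrite /h gerDl ler10 (addrC t0) addrK scale1r /v addrC subrK.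
- move=> _ [s /= hs <-]; rewrite in_itv /= in hs; move/andP: hs => [s0 s1].
  rewrite /h; case: leP => st.
    by apply: gD; exists s => //; rewrite /= in_itv /= s0 (le_trans st).
  by apply: SD; apply: hS; rewrite (ltW st).
Qed.

(** The set of points that can be reached from x and its complement in D are both open, since small
    balls in D contain the segments to their centres. *)
Lemma domain_lipschitz_arc D x y : domain D -> D x -> D y -> lipschitz_arc D x y.
Proof.
move=> [_ oD cD] Dx Dy; pose B := [set y | D y /\ lipschitz_arc D x y].
have seg p r q : D p -> (forall w, `|p - w| < r -> D w) -> `|p - q| < r ->
    forall t : R, 0 <= t <= 1 -> D (p + t *: (q - p)).
  move=> Dp Hr pq t /andP[t0 t1]; apply: Hr.
  rewrite opprD addrA subrr add0r normrN normrZ distrC ger0_norm//.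
  by apply: le_lt_trans pq; rewrite ler_piMl.
have seg' p r q : D p -> (forall w, `|p - w| < r -> D w) -> `|p - q| < r ->
    forall t : R, 0 <= t <= 1 -> D (q + t *: (p - q)).
  move=> Dp Hr pq t t01; have := seg p r q Dp Hr pq (1 - t).
  have -> : p + (1 - t) *: (q - p) = q + t *: (p - q).
    by rewrite scalerBl scale1r addrA (addrC p) subrK -scalerN opprB.
  by apply; case/andP: t01 => ? ?; apply/andP; split; lra.
have oB : open B.
  rewrite openE => p [Dp lp]; have [r r0 Hr] := open_ballP oD Dp.
  apply/nbhs_ballP; exists r => //= q; rewrite -ball_normE /= => pq.
  by split; [exact: Hr|exact: lipschitz_arc_extend lp (seg' p r q Dp Hr pq)].
have oDB : open (D `\` B).
  rewrite openE => p [Dp nlp]; have [r r0 Hr] := open_ballP oD Dp.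
  apply/nbhs_ballP; exists r => //= q; rewrite -ball_normE /= => pq.
  split; first exact: Hr.
  move=> [_ lq]; apply: nlp; split => //.
  exact: lipschitz_arc_extend lq (seg p r q Dp Hr pq).
suff DB : D = B by have [] : B y by rewrite -DB.
apply/esym/cD.
- by exists x; split => //; exact: lipschitz_arc_refl.
- by exists B => //; rewrite eqEsubset; split=> [q [? ?]//|q []].
- exists (~` (D `\` B)); first exact: open_closedC.
  rewrite eqEsubset; split=> [q Bq|q [Dq nq]]; first by split; [case: Bq|case].
  by apply: contrapT => nB; exact: nq.
Qed.

Lemma bdist_within D a b (g : R -> E) : proper_domain D ->
  {within `[a, b], continuous g} ->
  {within `[a, b], continuous (fun t => bdist D (g t) : R)}.
Proof.
move=> pD /within_continuousP cg; apply/within_continuousP => t ht e e0.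
have [d d0 H] := cg t ht e e0; exists d => // s hs ts.
apply: le_lt_trans (H s hs ts); rewrite ler_norml.
have := bdist_lip (g t) (g s) pD; have := bdist_lip (g s) (g t) pD.
by rewrite (distrC (g s)) => ? ?; apply/andP; split; lra.
Qed.

Lemma lipschitz_arc_length D x y a b g K : arc_joins_in D x y a b g ->
  (forall s t, s \in `[a, b] -> t \in `[a, b] -> `|g s - g t| <= K * `|s - t|) ->
  (arc_length a b g <= (K * (b - a))%:E)%E.
Proof. by move=> [[ab _ _] _ _ _]; exact: arc_length_lipschitz. Qed.

Definition qhlengths D x y : set \bar R := [set r | exists a b g,
  [/\ arc_joins_in D x y a b g, (arc_length a b g < +oo)%E
    & r = line_integral (fun z => (bdist D z)^-1) a b g]].

Lemma qhlengths_ge0 D x y : proper_domain D ->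
  (0 <= ereal_inf (qhlengths D x y))%E.
Proof.
move=> pD; apply: le_ereal_inf_tmp => _ [a [b [g [[[ab _ _] _ _ gD] _ ->]]]].
rewrite /line_integral; apply: integral_ge0 => t /=.
rewrite in_itv /= => /andP[t0 _]; have [u hu [-> _]] := arclength_param_itv g ab t0.
by rewrite lee_fin invr_ge0 ltW// bdist_gt0//; apply: gD; exists u.
Qed.

Lemma qhdist_ge0 D x y : proper_domain D -> 0 <= qhdist D x y.
Proof. by move=> pD; rewrite fine_ge0// qhlengths_ge0. Qed.

Lemma qhdist_ge D x y : proper_domain D -> D x -> D y ->
  ln (1 + `|x - y| / bdist D x) <= qhdist D x y.
Proof.
move=> pD Dx Dy; pose S := qhlengths D x y.
have lb : ((ln (1 + `|x - y| / bdist D x))%:E <= ereal_inf S)%E.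
  apply: le_ereal_inf_tmp => _ [a [b [g [[[ab _ _] ga gb gD] lfin ->]]]].
  rewrite -ga -gb distrC; apply: line_integral_ge => //.
    by rewrite ga bdist_gt0.
  move=> u hu; have Du : D (g u) by apply: gD; exists u.
  rewrite lef_pV2 ?posrE ?bdist_gt0//; last by rewrite ltr_pwDl// ga bdist_gt0.
  exact: bdist_lip.
(* Finiteness matters because [fine] sends an infinite value to 0. It follows from one Lipschitz
   arc, on which the distance to the boundary has a positive minimum. *)
have ub : (ereal_inf S < +oo)%E.
  have [a [b [g [K [arc lg]]]]] := domain_lipschitz_arc pD.1 Dx Dy.
  have [[ab cg ig] ga gb gD] := arc.
  have lfin : (arc_length a b g < +oo)%E.
    by apply: le_lt_trans (lipschitz_arc_length arc lg) _; rewrite ltry.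
  have [m hm Hm] := EVT_min ab (bdist_within pD cg).
  have m0 : 0 < bdist D (g m) by apply: bdist_gt0 => //; apply: gD; exists m.
  apply: (@le_lt_trans _ _ (line_integral (fun z => (bdist D z)^-1) a b g)).
    by apply: ereal_inf_lbound; exists a, b, g.
  apply: le_lt_trans (ltry _).
  apply: (@line_integral_le _ _ _ _ _ _ (bdist D (g m))^-1) => // u hu.
  have u0 : 0 < bdist D (g u) by apply: bdist_gt0 => //; apply: gD; exists u.
  by rewrite invr_ge0 (ltW u0) /= lef_pV2 ?posrE// Hm.
rewrite -lee_fin /qhdist fineK// ge0_fin_numE//; exact: qhlengths_ge0.
Qed.

(** Along the segment from x to y the distance to the boundary stays at least half of [bdist D x],
    and the length is at most t times [bdist D x]; hence the factor 2. *)
Lemma qhdist_le D x y (t : R) : proper_domain D -> D x -> 0 <= t <= 1 / 2 ->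
  `|x - y| <= t * bdist D x -> qhdist D x y <= 2 * t.
Proof.
move=> pD Dx /andP[t0 t1] xy; have d0 := bdist_gt0 pD Dx.
pose g s := x + s *: (y - x).
(* An arc is injective, so for x = y the parameter interval has to be a point. *)
pose b : R := if x == y then 0 else 1.
have b0 : 0 <= b by rewrite /b; case: ifP.
have lg r s : `|g r - g s| = `|x - y| * `|r - s|.
  by rewrite segment_lipschitz distrC.
have near s : s \in `[0, b] -> bdist D x / 2 <= bdist D (g s) /\ D (g s).
  move=> hs; have gx : `|x - g s| <= bdist D x / 2.
    have := lg 0 s; rewrite {1}/g scale0r addr0 => ->.
    have s1 : `|0 - s| <= 1.
      rewrite sub0r normrN ger0_norm ?(itvP hs)//; move: hs; rewrite /b.
      by case: ifP => _ hs; rewrite ?(itvP hs)// (le_trans _ ler01)// (itvP hs).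
    have := normr_ge0 (x - y); have := normr_ge0 (0 - s); nra.
  split; first by have := bdist_lip x (g s) pD; lra.
  apply: (bdist_ball pD Dx); apply: le_lt_trans gx _; lra.
have arc : arc_joins_in D x y 0 b g.
  split.
  - split => //; first by apply: (@lipschitz_within _ _ _ _ `|x - y|) => r s _ _; rewrite lg.
    move=> r s; rewrite !inE /= => hr hs grs.
    have : `|x - y| * `|r - s| = 0 by rewrite -lg grs subrr normr0.
    move/eqP; rewrite mulf_eq0 => /orP[|]; last first.
      by rewrite normr_eq0 subr_eq0 => /eqP.
    rewrite normr_eq0 subr_eq0 => xy0; move: hr hs; rewrite /b xy0 !in_itv /=.
    by move=> /le_anti <- /le_anti <-.
  - by rewrite /g scale0r addr0.
  - by rewrite /g /b; case: eqP => [->|_]; rewrite ?subrr ?scaler0 ?addr0// scale1r addrC subrK.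
  - by move=> _ [s hs <-]; case: (near s hs).
have la : (arc_length 0 b g <= (`|x - y| * (b - 0))%:E)%E.
  by apply: arc_length_lipschitz => // r s _ _; rewrite lg.
have lfin : (arc_length 0 b g < +oo)%E by apply: le_lt_trans la (ltry _).
have lel : fine (arc_length 0 b g) <= `|x - y|.
  rewrite -lee_fin fineK ?ge0_fin_numE ?arc_length_ge0//; apply: le_trans la _.
  by rewrite lee_fin subr0 /b; case: ifP; rewrite ?mulr0 ?mulr1.
rewrite /qhdist -[leRHS]/(fine (2 * t)%:E); apply: fine_le => //.
  rewrite ge0_fin_numE ?qhlengths_ge0//.
  apply: (@le_lt_trans _ _ (line_integral (fun z => (bdist D z)^-1) 0 b g)).
    by apply: ereal_inf_lbound; exists 0, b, g.
  apply: le_lt_trans (ltry _); apply: (@line_integral_le _ _ _ _ _ _ (bdist D x / 2)^-1) => //.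
  move=> u /near[h _]; rewrite invr_ge0 lef_pV2 ?posrE ?divr_gt0//; last first.
    by apply: lt_le_trans h; rewrite divr_gt0.
  by rewrite h andbT (le_trans _ h)// divr_ge0// ltW.
apply: (@le_trans _ _ (line_integral (fun z => (bdist D z)^-1) 0 b g)).
  by apply: ereal_inf_lbound; exists 0, b, g.
apply: (@le_trans _ _ ((bdist D x / 2)^-1 * fine (arc_length 0 b g))%:E).
  apply: line_integral_le => // u /near[h _].
  rewrite invr_ge0 lef_pV2 ?posrE ?divr_gt0//; last by apply: lt_le_trans h; rewrite divr_gt0.
  by rewrite h andbT (le_trans _ h)// divr_ge0// ltW.
rewrite lee_fin invf_div -mulrA [_^-1 * _]mulrC ler_pM2l// ler_pdivrMr//.
exact: le_trans xy.
Qed.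

End quasihyperbolic.

(** * The j-distance and chains of close points *)

Section close.
Context {R : realType} {E : normedModType R}.
Implicit Types (d : E -> R) (K : R).

(* [close d K] says that the j-distance ln (1 + |x - y| / min (d x) (d y)) is
   at most ln K. *)
Definition close d K x y : Prop :=
  `|x - y| <= (K - 1) * d x /\ `|x - y| <= (K - 1) * d y.

Definition lip1 d : Prop := forall x y, d x <= d y + `|x - y|.

Lemma close_sym d K x y : close d K x y -> close d K y x.
Proof. by rewrite /close distrC => -[]. Qed.

(** The triangle inequality of the j-distance in exponential form: distances add, factors
    multiply. *)
Lemma close_trans d K K' x y z : lip1 d -> 1 <= K -> 1 <= K' ->
  close d K x y -> close d K' y z -> close d (K * K') x z.
Proof.
move=> ld K1 K'1 [a1 a2] [b1 b2]; have h := ler_distD y x z.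
have hx := ld y x; have hz := ld y z; rewrite (distrC y x) in hx.
by split; nra.
Qed.

Lemma close_mono d K K' x y : 0 <= d x -> 0 <= d y -> K <= K' ->
  close d K x y -> close d K' x y.
Proof. by move=> ? ? ? [? ?]; split; nra. Qed.

Lemma close_dist d K x y : lip1 d -> close d K x y -> d y <= K * d x.
Proof. by move=> /(_ y x) h [h' _]; rewrite distrC in h; nra. Qed.

End close.

Lemma close_segment (R : realType) (E F : normedModType R) (d : F -> R)
    (g : E -> F) (u v : E) (eta M : R) (n : nat) :
  lip1 d -> 1 <= M ->
  (forall s t : R, 0 <= s <= 1 -> 0 <= t <= 1 -> `|s - t| * `|v - u| <= eta ->
    close d M (g (u + s *: (v - u))) (g (u + t *: (v - u)))) ->
  `|v - u| <= n.+1%:R * eta -> close d (M ^+ n.+1) (g u) (g v).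
Proof.
move=> ld M1 step uv; pose p k := u + (k%:R / n.+1%:R) *: (v - u).
have n0 : (0 : R) < n.+1%:R by rewrite ltr0n.
suff H : forall k, (k <= n)%N -> close d (M ^+ k.+1) (g u) (g (p k.+1)).
  by have := H n (leqnn n); rewrite /p divff ?gt_eqF// scale1r addrC subrK.
have small : forall k, (k < n.+1)%N -> close d M (g (p k)) (g (p k.+1)).
  move=> k kn; apply: step.
  - by rewrite divr_ge0//= ler_pdivrMr// mul1r ler_nat ltnW.
  - by rewrite divr_ge0//= ler_pdivrMr// mul1r ler_nat.
  - rewrite -mulrBl distrC in uv *.
    have -> : k%:R - k.+1%:R = - 1 :> R by rewrite -[k.+1]addn1 natrD; ring.
    rewrite mulN1r normrN ger0_norm ?invr_ge0 ?(ltW n0)// distrC mulrC.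
    by rewrite ler_pdivrMr// mulrC (distrC v).
elim=> [_|k ih kn].
  by rewrite expr1; have := small 0 isT; rewrite {1}/p mul0r scale0r addr0.
rewrite exprSr; apply: close_trans (ih _) (small _ _) => //; last exact: ltnW.
by rewrite exprn_ege1.
Qed.

(** * Joining two points by segments that avoid the origin *)

Section two_segments.
Context {R : realType} {E : normedModType R}.

(* Riesz lemma for a line, whose distance to a point is attained. *)
Lemma riesz_line (u : E) : dim_ge2 E -> u != 0 ->
  exists2 w : E, `|w| = `|u| & forall a b : R, `|a| * `|u| <= `|a *: w + b *: u|.
Proof.
move=> [p [q pq]] u0; have nu0 : 0 < `|u| by rewrite normr_gt0.
have [w0 w0u] : exists w0 : E, forall t : R, w0 - t *: u != 0.
  have [hp|/existsNP[t ht]] := pselect (forall t : R, p - t *: u != 0).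
    by exists p.
  exists q => s; apply/negP => /eqP hq; move: ht => /negP; rewrite negbK.
  rewrite subr_eq0 => /eqP ht; move/eqP: hq; rewrite subr_eq0 => /eqP hs.
  have [] := pq s (- t).
    by rewrite ht hs !scalerA mulNr scaleNr mulrC subrr.
  move=> _ /eqP; rewrite oppr_eq0 => /eqP t0.
  have [] := pq 1 0; first by rewrite ht t0 scale0r scaler0 scale0r addr0.
  by move=> /eqP; rewrite oner_eq0.
pose h (t : R) := `|w0 - t *: u|.
have ch : {within `[- (2 * `|w0| / `|u|), 2 * `|w0| / `|u|], continuous h}.
  apply/within_continuousP => t _ e e0; exists (e / `|u|) => [|s _ ts]; first by rewrite divr_gt0.
  apply: le_lt_trans (ler_dist_dist _ _) _.
  by rewrite opprB addrC subrKA -scalerBl normrZ distrC -ltr_pdivlMr.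
have T0 : 0 <= 2 * `|w0| / `|u| by rewrite divr_ge0// mulr_ge0.
have [|t0 _ Ht0] := EVT_min _ ch; first by rewrite (le_trans _ T0)// oppr_le0.
have min t : h t0 <= h t.
  have [tT|Tt] := leP `|t| (2 * `|w0| / `|u|).
    by apply: Ht0; rewrite in_itv /= -ler_norml.
  have h0 : h t0 <= `|w0|.
    by have := Ht0 0; rewrite in_itv /= oppr_le0 T0 {2}/h scale0r subr0 => /(_ isT).
  apply: le_trans h0 _; rewrite ltr_pdivrMr// in Tt.
  by have := lerB_dist (t *: u) w0; rewrite distrC normrZ /h; lra.
have m0 : 0 < h t0 by rewrite normr_gt0 w0u.
exists ((`|u| / h t0) *: (w0 - t0 *: u)) => [|a b].
  by rewrite normrZ ger0_norm ?divr_ge0 ?(ltW m0)// -/(h t0) divfK ?gt_eqF.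
have [->|a0] := eqVneq a 0; first by rewrite normr0 mul0r.
set k := a * (`|u| / h t0).
have k0 : k != 0 by rewrite mulf_neq0// gt_eqF// divr_gt0.
have -> : a *: ((`|u| / h t0) *: (w0 - t0 *: u)) + b *: u =
    k *: (w0 - (t0 - b / k) *: u).
  rewrite scalerA -/k !scalerBr !scalerA -addrA -scaleNr -scalerDl -scaleNr.
  by congr (_ + _ *: _); field.
rewrite normrZ -/(h _); apply: (@le_trans _ _ (`|k| * h t0)); last first.
  by rewrite ler_wpM2l.
rewrite normrM (ger0_norm (x := `|u| / h t0)); last by rewrite divr_ge0// ltW.
by rewrite -mulrA divfK ?gt_eqF.
Qed.

(* The detour through [w] is needed when [u] and [v] are nearly opposite. *)
Lemma two_segments (u v : E) (k : R) : dim_ge2 E -> 1 <= k -> u != 0 ->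
  `|v| <= `|u| -> `|u| <= k * `|v| ->
  exists2 w : E, `|w| <= `|u| & forall t : R, 0 <= t <= 1 ->
    `|u| / (32 * k) <= `|u + t *: (w - u)| /\
    `|u| / (32 * k) <= `|w + t *: (v - w)|.
Proof.
move=> dimE k1 u0 vu uv; have nu0 : 0 < `|u| by rewrite normr_gt0.
set rho := `|u| in nu0 vu uv *; set eta := rho / (32 * k).
have k0 : 0 < k by lra.
have eta0 : 0 < eta by rewrite divr_gt0// mulr_gt0.
have etaE : 32 * k * eta = rho by rewrite /eta; field; rewrite gt_eqF.
have etarho : 32 * eta <= rho by nra.
have cv (p q : E) t : p + t *: (q - p) = (1 - t) *: p + t *: q.
  by rewrite scalerBl scale1r scalerBr addrA addrAC.
(* If the straight segment avoids the ball of radius [eta], the choice [w := u] makes the first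
   segment constant. Otherwise w is taken transversal to u. *)
have [H|/existsNP[t0 /not_implyP[/andP[t00 t01] /negP]]] := pselect (forall t : R, 0 <= t <= 1 ->
    eta <= `|u + t *: (v - u)|).
  exists u => // t t01; split; last exact: H.
  by rewrite subrr scaler0 addr0 -/rho; lra.
rewrite -ltNge cv => ht0.
have [w nw Hw] := riesz_line dimE u0; rewrite -/rho in nw Hw.
exists w => [|t /andP[t0' t1']]; first by rewrite nw.
have t04 : 1 / 4 < t0.
  have := lerB_dist ((1 - t0) *: u) (- (t0 *: v)); rewrite opprK normrN !normrZ.
  rewrite !ger0_norm ?subr_ge0// -/rho; nra.
split; rewrite cv.
  have h1 := Hw t (1 - t); rewrite addrC ger0_norm// in h1.
  have := lerB_dist ((1 - t) *: u) (- (t *: w)); rewrite opprK normrN !normrZ nw -/rho.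
  rewrite !ger0_norm ?subr_ge0//; have [t3|t3] := leP (1 / 3) t; nra.
(* The straight segment comes within [eta] of 0 at t0 > 1 / 4, so v is within 4 [eta] of - r u. On
   the second segment the component along w then gives the lower bound (1 - t) |u| - 4 [eta]. *)
set r := (1 - t0) / t0.
have hr : `|v + r *: u| <= 4 * eta.
  have -> : v + r *: u = t0^-1 *: ((1 - t0) *: u + t0 *: v).
    rewrite scalerDr !scalerA mulVf ?gt_eqF//; last lra.
    by rewrite scale1r addrC mulrC.
  rewrite normrZ ger0_norm ?invr_ge0// mulrC ler_pdivrMr; last lra.
  by apply: le_trans (ltW ht0) _; nra.
have b1 : (1 - t) * rho - 4 * eta <= `|(1 - t) *: w + t *: v|.
  have -> : (1 - t) *: w + t *: v =
      ((1 - t) *: w + (- t * r) *: u) - (- t) *: (v + r *: u).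
    by rewrite scalerDr scalerA opprD addrA addrAC addrK scaleNr opprK.
  apply: le_trans _ (lerB_dist _ _); rewrite [in leRHS]normrZ normrN.
  have := Hw (1 - t) (- t * r); rewrite !ger0_norm ?subr_ge0// => ?.
  have := normr_ge0 (v + r *: u); nra.
have b2 : t * `|v| - (1 - t) * rho <= `|(1 - t) *: w + t *: v|.
  have := lerB_dist (t *: v) (- ((1 - t) *: w)); rewrite opprK normrN !normrZ nw.
  by rewrite !ger0_norm ?subr_ge0// [_ *: w + _]addrC.
(* Close to v the component along w is too small; there t |v| dominates, because |v| is at least 32
   [eta] and (1 - t) |u| at most 8 [eta]. *)
have [t4|t4] := leP (1 / (4 * k)) (1 - t).
  have : rho / (4 * k) <= (1 - t) * rho.
    by rewrite mulrC ler_wpM2r ?(ltW nu0)// -div1r.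
  have -> : rho / (4 * k) = 8 * eta by rewrite /eta; field; rewrite gt_eqF.
  lra.
have kv : 32 * eta <= `|v| by nra.
have : (1 - t) * rho <= 8 * eta.
  have -> : 8 * eta = 1 / (4 * k) * rho by rewrite /eta; field; rewrite gt_eqF.
  by rewrite ler_wpM2r ?(ltW nu0)// ltW.
have : 1 / (4 * k) <= 1 / 4 by rewrite ler_pdivrMr; [lra|lra].
nra.
Qed.

End two_segments.

(** * Solid maps at small scale *)

Section distortion.
Context {R : realType}.
Context (phi : R -> R).
Context (hphi : homeo (`[0, +oo[ : set R) (`[0, +oo[ : set R) phi).
Context (phi_ge : forall t : R, 0 <= t -> t <= phi t).

Lemma distortion0 : phi 0 = 0.
Proof.
have [g [[_ _ surj] _ _ _]] := hphi.
have [|s] := surj 0; first by rewrite /= in_itv /= lexx.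
rewrite /= in_itv /= andbT => s0 fs.
by rewrite -[in LHS](_ : s = 0)//; apply/le_anti; rewrite s0 -fs phi_ge.
Qed.

Lemma distortion_bounded : exists2 M : R, 1 <= M &
  forall s, 0 <= s <= 1 -> phi s <= ln M.
Proof.
have [g [_ cphi _ _]] := hphi.
have [|s hs Hs] := @EVT_max _ phi 0 1 ler01.
  apply: continuous_subspaceW cphi => s /=.
  by rewrite !in_itv /= andbT => /andP[].
have s0 : 0 <= phi s by apply: le_trans (phi_ge _); rewrite (itvP hs).
exists (expR (phi s)) => [|t t01]; first by rewrite -expR0 ler_expR.
by rewrite expRK; apply: Hs; rewrite in_itv.
Qed.

Lemma distortion_small (M : R) : 1 < M -> exists2 t : R, 0 < t <= 1 / 4 &
  forall s, 0 <= s <= 3 * t -> phi s <= ln M.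
Proof.
move=> M1; have [g [_ /within_continuousP cphi _ _]] := hphi.
have [||d d0 Hd] := cphi 0 _ (ln M); first by rewrite /= in_itv /= lexx.
  by rewrite ln_gt0.
exists (Num.min (1 / 4) (d / 6)).
  by rewrite lt_min ge_min lexx /= andbT; apply/andP; split; lra.
move=> s /andP[s0 s1]; rewrite distortion0 in Hd.
have : `|0 - phi s| < ln M.
  apply: Hd; first by rewrite /= in_itv /= s0.
  rewrite sub0r normrN ger0_norm//; apply: le_lt_trans s1 _.
  have : Num.min (1 / 4) (d / 6) <= d / 6 by rewrite ge_min lexx orbT.
  lra.
by rewrite sub0r normrN => /ltW; apply: le_trans; rewrite ler_norm.
Qed.

End distortion.

Section steps.
Context {R : realType}.
Implicit Types (E F : normedModType R).

Definition mutually_inverse E F (D : set E) (D' : set F) (f : E -> F)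
    (g : F -> E) : Prop :=
  (forall x, D x -> D' (f x) /\ g (f x) = x) /\
  (forall u, D' u -> D (g u) /\ f (g u) = u).

Lemma homeo_inv_mutually_inverse E F (D : set E) (D' : set F) f g :
  homeo_inv D D' f g -> mutually_inverse D D' f g.
Proof.
move=> [[fD inj surj] _ _ gf]; split=> [x Dx|u Du].
  by split; [exact: fD|exact: gf (mem_set Dx)].
have [x Dx <-] := surj u Du; rewrite gf ?inE//.
Qed.

Lemma lip1_bdist E (D : set E) : proper_domain D -> lip1 (bdist D).
Proof. by move=> pD x y; exact: bdist_lip. Qed.

(* Distances comparable to the distance to the boundary are the only ones at
   which solidity is used. *)
Definition solid_step (phi : R -> R) E F (D : set E) (D' : set F) (f : E -> F)
    : Prop :=
  forall t M : R, 0 <= t <= 1 / 4 -> 1 <= M ->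
    (forall s, 0 <= s <= 3 * t -> phi s <= ln M) ->
  forall x y, D x -> D y -> `|x - y| <= t * bdist D x ->
    close (bdist D') M (f x) (f y).

Lemma qhdist_solid_step phi E F (D : set E) (D' : set F) f :
  proper_domain D -> proper_domain D' -> (forall x, D x -> D' (f x)) ->
  (forall x y, D x -> D y -> qhdist D' (f x) (f y) <= phi (qhdist D x y)) ->
  solid_step phi D D' f.
Proof.
move=> pD pD' fD hf t M /andP[t0 t1] M1 hphi x y Dx Dy xy.
(* The estimate is also needed from y, where |x - y| is at most 3 / 2 t times the distance to the
   boundary. Doubling 3 / 2 t, as in [qhdist_le], gives the 3 t at which [phi] is controlled. *)
have key x1 y1 : D x1 -> D y1 -> `|x1 - y1| <= (3 / 2 * t) * bdist D x1 ->
    `|f x1 - f y1| <= (M - 1) * bdist D' (f x1).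
  move=> Dx1 Dy1 h; have d0 := bdist_gt0 pD' (fD _ Dx1).
  have k1 : qhdist D x1 y1 <= 2 * (3 / 2 * t).
    by apply: qhdist_le => //; apply/andP; split; lra.
  have k2 : qhdist D' (f x1) (f y1) <= ln M.
    by apply: le_trans (hf x1 y1 Dx1 Dy1) (hphi _ _); rewrite qhdist_ge0//=; lra.
  have := le_trans (qhdist_ge pD' (fD _ Dx1) (fD _ Dy1)) k2.
  rewrite ler_ln ?posrE; [|by rewrite ltr_pwDl// divr_ge0// ltW|lra].
  by rewrite -lerBrDl ler_pdivrMr.
have d0 := bdist_gt0 pD Dx; have ? : 0 <= t * bdist D x by rewrite mulr_ge0// ltW.
split; first by apply: key => //; lra.
rewrite distrC; apply: key => //.
have := bdist_lip x y pD; rewrite (distrC y x) => ?; nra.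
Qed.

Definition FQ_steps (phi : R -> R) E F (D : set E) (f : E -> F) (g : F -> E) :=
  forall D1, domain D1 -> D1 `<=` D ->
    [/\ proper_domain D1, proper_domain (f @` D1),
      solid_step phi D1 (f @` D1) f & solid_step phi (f @` D1) D1 g].

(** Each subdomain comes with an inverse of its own; all of them agree with the single [g] on the
    images. *)
Lemma FQC_steps phi E F (D : set E) (D' : set F) f g :
  mutually_inverse D D' f g -> FQC phi D D' f -> FQ_steps phi D f g.
Proof.
move=> [fg gf] [_ _ _ H] D1 dD1 D1D; have [p1 p2 [h [hh h1 h2]]] := H D1 dD1 D1D.
have [fh hf] := homeo_inv_mutually_inverse hh.
split => //; first by apply: qhdist_solid_step => // x; exists x.
apply: qhdist_solid_step => // [_ [x D1x <-]|u v [x D1x <-] [y D1y <-]].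
  by rewrite (fg x (D1D _ D1x)).2.
have := h2 (f x) (f y); rewrite !(fg _ (D1D _ _)).2// !(fh _ _).2//.
by apply; [exists x|exists y].
Qed.

Lemma image_domain E F (D : set E) (D' : set F) f g (D1 : set E) :
  mutually_inverse D D' f g -> open D' -> {within D, continuous f} ->
  {within D', continuous g} -> domain D1 -> D1 `<=` D -> open D ->
  domain (f @` D1).
Proof.
move=> [fg gf] oD' cf cg [[x D1x] oD1 cD1] D1D oD; split.
- by exists (f x), x.
- rewrite openE => _ [y D1y <-].
  have [r r0 Hr] := open_ballP oD' (fg _ (D1D _ D1y)).1.
  have [e e0 He] := open_ballP oD1 D1y.
  have [d d0 Hd] := (within_continuousP _ _).1 cg (f y) (fg _ (D1D _ D1y)).1 e e0.
  apply/nbhs_ballP; exists (Num.min r d) => /=; first by rewrite lt_min r0.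
  move=> u; rewrite -ball_normE /= lt_min => /andP[/Hr D'u yu].
  exists (g u); last exact: (gf _ D'u).2.
  by apply: He; have := Hd u D'u yu; rewrite (fg _ (D1D _ D1y)).2.
- apply: connected_continuous_connected => //.
  exact: continuous_subspaceW D1D cf.
Qed.

Lemma FQ_steps_inv phi E F (D : set E) (D' : set F) f g :
  mutually_inverse D D' f g -> open D -> open D' -> {within D, continuous f} ->
  {within D', continuous g} -> FQ_steps phi D f g -> FQ_steps phi D' g f.
Proof.
move=> fg oD oD' cf cg H D1 dD1 D1D'.
have gf : mutually_inverse D' D g f by case: fg.
have dg : domain (g @` D1) by exact: image_domain gf _ _ _ _ _ _.
have sub : g @` D1 `<=` D by move=> _ [u D1u <-]; exact: (fg.2 _ (D1D' _ D1u)).1.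
have [p1 p2 s1 s2] := H _ dg sub.
suff E1 : f @` (g @` D1) = D1 by rewrite E1 in p2 s1 s2.
rewrite eqEsubset; split=> [_ [_ [u D1u <-] <-]|u D1u].
  by rewrite (fg.2 _ (D1D' _ D1u)).2.
by exists (g u); [exists u|exact: (fg.2 _ (D1D' _ D1u)).2].
Qed.

End steps.

(** * Punctured balls and the local Hölder estimate *)

Section punctured_ball.
Context {R : realType} {E : normedModType R}.

Definition punctured_ball (x : E) (r : R) : set E := [set y | 0 < `|y - x| < r].

Lemma nonzero_vector : dim_ge2 E -> exists v : E, v != 0.
Proof.
move=> [u [v uv]]; exists u; apply/eqP => u0.
have [] := uv 1 0; first by rewrite u0 scaler0 scale0r addr0.
by move=> /eqP; rewrite oner_eq0.
Qed.

Lemma punctured_ball_arbitrarily_small (x : E) (e : R) : dim_ge2 E -> 0 < e ->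
  exists2 y, y != x & `|x - y| < e.
Proof.
move=> /nonzero_vector[v v0] e0; have nv : 0 < `|v| by rewrite normr_gt0.
exists (x + (e / 2 / `|v|) *: v).
  by rewrite -subr_eq0 addrC addKr scaler_eq0 (negbTE v0) orbF gt_eqF// !divr_gt0.
rewrite opprD addrA subrr add0r normrN normrZ ger0_norm ?divfK ?gt_eqF//.
  lra.
by rewrite !divr_ge0// ltW.
Qed.

Lemma norm_segment_le (p q : E) (r t : R) : 0 <= t <= 1 -> `|p| <= r ->
  `|q| <= r -> `|p + t *: (q - p)| <= r.
Proof.
move=> /andP[t0 t1] hp hq.
have -> : p + t *: (q - p) = (1 - t) *: p + t *: q.
  by rewrite scalerBl scale1r scalerBr addrA addrAC.
apply: le_trans (ler_normD _ _) _; rewrite !normrZ !ger0_norm ?subr_ge0//; nra.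
Qed.

Lemma connected_segment (p q : E) :
  connected ((fun t : R => p + t *: (q - p)) @` `[0, 1]).
Proof.
apply: connected_continuous_connected; first exact: segment_connected.
by apply: (@lipschitz_within _ _ _ _ `|q - p|) => s t _ _; rewrite segment_lipschitz.
Qed.

(** Connectedness comes from [two_segments]: any two points of the punctured ball lie on a pair of
    segments with a common end that miss the centre. *)
Lemma domain_punctured_ball (x : E) (r : R) : dim_ge2 E -> 0 < r ->
  domain (punctured_ball x r).
Proof.
move=> dimE r0; split.
- have [y yx xy] := punctured_ball_arbitrarily_small x dimE r0.
  by exists y; rewrite /punctured_ball /= normr_gt0 subr_eq0 yx distrC.
- rewrite openE => y /= /andP[y0 yr]; apply/nbhs_ballP.
  exists (Num.min `|y - x| (r - `|y - x|)) => /=; first by rewrite lt_min y0 subr_gt0.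
  move=> z; rewrite -ball_normE /= lt_min => /andP[h1 h2].
  have := ler_distD z y x; have := ler_distD y z x; rewrite (distrC z y) => ? ?.
  by apply/andP; split; lra.
have join u v : 0 < `|u| < r -> 0 < `|v| < r -> `|v| <= `|u| ->
    exists C, [/\ C `<=` punctured_ball x r, C (x + u), C (x + v) & connected C].
  move=> /andP[u0 ur] /andP[v0 vr] vu.
  have k1 : 1 <= `|u| / `|v| by rewrite ler_pdivlMr// mul1r.
  have [||w wu Hw] := two_segments dimE k1 _ vu; first by rewrite -normr_gt0.
    by rewrite divfK// gt_eqF.
  have eta0 : 0 < `|u| / (32 * (`|u| / `|v|)) by rewrite !(divr_gt0, mulr_gt0).
  pose S (p q : E) := (fun t : R => (x + p) + t *: ((x + q) - (x + p))) @` `[0, 1].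
  exists (S u w `|` S w v); split.
  + have Sp p q : `|p| <= `|u| -> `|q| <= `|u| ->
        (forall t : R, 0 <= t <= 1 -> 0 < `|p + t *: (q - p)|) ->
        S p q `<=` punctured_ball x r.
      move=> hp hq H _ [t /= t01 <-]; rewrite in_itv /= in t01.
      rewrite /punctured_ball /= opprD addrACA subrr add0r -(addrA x) (addrC x) addrK.
      by rewrite H// (le_lt_trans _ ur)// norm_segment_le.
    move=> y [] /Sp; apply => // t t01; apply: lt_le_trans eta0 _;
      by have [] := Hw t t01.
  + by left; exists 0; rewrite /= ?in_itv /= ?lexx ?ler01// scale0r addr0.
  + by right; exists 1; rewrite /= ?in_itv /= ?lexx ?ler01// scale1r addrC subrK.
  + apply: connectedU; [|exact: connected_segment..].
    exists (x + w); split.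
      by exists 1; rewrite /= ?in_itv /= ?lexx ?ler01// scale1r addrC subrK.
    by exists 0; rewrite /= ?in_itv /= ?lexx ?ler01// scale0r addr0.
have join2 p q : punctured_ball x r p -> punctured_ball x r q ->
    exists C, [/\ C `<=` punctured_ball x r, C p, C q & connected C].
  have xE y : y = x + (y - x) by rewrite addrC subrK.
  rewrite /punctured_ball /= => hp hq; have [pq|/ltW qp] := leP `|q - x| `|p - x|.
    by have := join _ _ hp hq pq; rewrite -!xE.
  by have [C [? Cq Cp ?]] := join _ _ hq hp qp; rewrite -!xE in Cq Cp; exists C.
have [y yx xy] := punctured_ball_arbitrarily_small x dimE r0.
have py : punctured_ball x r y.
  by rewrite /punctured_ball /= normr_gt0 subr_eq0 yx distrC.
(* A chosen connected set joining q to the fixed point y; the punctured ball is the union of these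
   sets, which all contain y. *)
pose A q := if pselect (punctured_ball x r q) is left h
  then projT1 (cid (join2 y q py h)) else set0.
have -> : punctured_ball x r = \bigcup_(q in punctured_ball x r) A q.
  rewrite eqEsubset; split=> [q pq|q [p pp]].
    by exists q => //; rewrite /A; case: pselect => // h; case: cid => C [].
  by rewrite /A; case: pselect => // h; case: cid => C /= [sub _ _ _] /sub.
apply: bigcup_connected.
  by exists y => q pq; rewrite /A; case: pselect => // h; case: cid => C [].
by move=> q pq; rewrite /A; case: pselect => // h; case: cid => C [].
Qed.

End punctured_ball.

Lemma lip1_dist (R : realType) (E : normedModType R) (x : E) :
  lip1 (fun y => `|y - x|).
Proof. by move=> y z; rewrite [leRHS]addrC; exact: ler_distD. Qed.

Lemma expr_gt_exists (R : realType) (a k : R) : 1 < a -> exists n, k < a ^+ n.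
Proof.
move=> a1; have a0 : 0 < a - 1 by lra.
exists (Num.truncn (k / (a - 1))).+1; set n := _.+1.
have kn : k / (a - 1) < n%:R by exact: truncnS_gt.
have bern m : 1 + m%:R * (a - 1) <= a ^+ m.
  elim: m => [|m ih]; first by rewrite mul0r addr0 expr0.
  rewrite exprSr -natr1; have : 0 <= m%:R :> R by [].
  have : 0 <= m%:R * (a - 1) by rewrite mulr_ge0// ltW.
  nra.
have := bern n; rewrite ltr_pdivrMr// in kn; lra.
Qed.

(** The two segments given by [two_segments] stay at distance at least |u - x'| / (32 k) from x', so
    steps of a quarter of that length are admissible. Each segment has length at most 2 |u - x'|,
    that is 256 k such steps. *)
Lemma annulus_close (R : realType) (E F : normedModType R) (g : F -> E)
    (x : E) (x' : F) (r' M k : R) (n : nat) :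
  dim_ge2 F -> 1 <= M -> 1 <= k -> 256 * k <= n.+1%:R ->
  (forall u v, 0 < `|u - x'| <= r' -> 0 < `|v - x'| <= r' ->
    `|u - v| <= `|u - x'| / 4 -> close (fun y => `|y - x|) M (g u) (g v)) ->
  forall u v, 0 < `|u - x'| <= r' -> 0 < `|v - x'| <= r' ->
    `|v - x'| <= k * `|u - x'| -> `|u - x'| <= k * `|v - x'| ->
    close (fun y => `|y - x|) (M ^+ n.+1 * M ^+ n.+1) (g u) (g v).
Proof.
move=> dimF M1 k1 kn step.
suff H u v : 0 < `|u - x'| <= r' -> 0 < `|v - x'| <= r' ->
    `|v - x'| <= `|u - x'| -> `|u - x'| <= k * `|v - x'| ->
    close (fun y => `|y - x|) (M ^+ n.+1 * M ^+ n.+1) (g u) (g v).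
  move=> u v hu hv vu uv; have [h|/ltW h] := leP `|v - x'| `|u - x'|; first exact: H.
  by apply: close_sym; exact: H.
move=> /andP[u0 ur] /andP[v0 vr] vu uv.
have uE y : y = x' + (y - x') by rewrite addrC subrK.
have [|w wu Hw] := two_segments dimF k1 _ vu uv; first by rewrite -normr_gt0.
set eta := `|u - x'| / (32 * k) in Hw.
have k0 : 0 < k by lra.
have eta0 : 0 < eta by rewrite divr_gt0// mulr_gt0.
have seg p q : `|p| <= `|u - x'| -> `|q| <= `|u - x'| ->
    (forall t : R, 0 <= t <= 1 -> eta <= `|p + t *: (q - p)|) ->
    close (fun y => `|y - x|) (M ^+ n.+1) (g (x' + p)) (g (x' + q)).
  move=> hp hq H.
  apply: (@close_segment _ _ _ _ (fun y => g (x' + y)) _ _ (eta / 4)) => //.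
  - exact: lip1_dist.
  - move=> s t s01 t01 hst.
    have nrm r : 0 <= r <= 1 -> 0 < `|x' + (p + r *: (q - p)) - x'| <= r'.
      move=> r01; rewrite (addrC x') addrK (lt_le_trans eta0 (H r r01)) /=.
      by apply: le_trans _ ur; exact: norm_segment_le.
    apply: step; rewrite ?nrm//.
    rewrite opprD addrACA subrr add0r segment_lipschitz mulrC.
    apply: le_trans hst _; rewrite ler_pM2r// (addrC x') addrK; exact: H.
  - apply: (@le_trans _ _ (2 * `|u - x'|)).
      by apply: le_trans (ler_normB _ _) _; lra.
    have -> : `|u - x'| = 32 * k * eta by rewrite /eta; field; rewrite gt_eqF.
    nra.
have Mn : 1 <= M ^+ n.+1 by rewrite exprn_ege1.
rewrite [u]uE [v]uE; apply: (@close_trans _ _ _ _ _ _ (g (x' + w))) => //.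
- exact: lip1_dist.
- by apply: seg => // t t01; have [] := Hw t t01.
- by apply: seg => // t t01; have [] := Hw t t01.
Qed.

(* If [f] failed to halve the distance to [f x] along a long piece of the ray
   from [x] to [y], two far apart points of the ray would have images at
   comparable distances from [f x], against the distortion of the inverse
   [g]. *)
Lemma punctured_decay (R : realType) (M : R) : 1 <= M ->
  exists2 n : nat, (0 < n)%N & forall (E F : normedModType R) (f : E -> F)
    (g : F -> E) (x : E) (r r' : R), dim_ge2 F ->
  (forall y, 0 < `|y - x| <= r -> 0 < `|f y - f x| <= r' /\ g (f y) = y) ->
  (forall y, 0 < `|y - x| <= r ->
    `|f y - f x| <= M * `|f (x + (3 / 4) *: (y - x)) - f x|) ->
  (forall u v, 0 < `|u - f x| <= r' -> 0 < `|v - f x| <= r' ->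
    `|u - v| <= `|u - f x| / 4 -> close (fun y => `|y - x|) M (g u) (g v)) ->
  (forall e, 0 < e -> exists2 d, 0 < d & forall y, `|y - x| <= d ->
    `|f y - f x| <= e) ->
  forall y, 0 < `|y - x| <= r ->
    `|f (x + (3 / 4) ^+ n *: (y - x)) - f x| <= `|f y - f x| / 2.
Proof.
(* The factor 2 covers images at half the initial distance, the factor [M] those that are farther
   away. *)
move=> M1; pose k := 2 * M; have k1 : 1 <= k by rewrite /k; lra.
pose m := Num.truncn (256 * k).
have hm : 256 * k <= m.+1%:R by rewrite ltW// truncnS_gt.
pose K := M ^+ m.+1 * M ^+ m.+1.
have [|n Hn] := @expr_gt_exists R (4 / 3) K; first lra.
have K1 : 1 <= K by rewrite mulr_ege1// exprn_ege1.
exists n => [|E F f g x r r' dimF hr h1 h2 h3 y hy].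
  by case: n Hn => //; rewrite expr0 ltNge K1.
pose p j := x + (3 / 4) ^+ j *: (y - x); pose s j := `|f (p j) - f x|.
have q0 j : 0 < (3 / 4) ^+ j :> R by rewrite exprn_gt0; lra.
have q1 j : (3 / 4) ^+ j <= 1 :> R by rewrite exprn_ile1; lra.
have px j : `|p j - x| = (3 / 4) ^+ j * `|y - x|.
  by rewrite /p addrC addKr normrZ gtr0_norm.
have pr j : 0 < `|p j - x| <= r.
  rewrite px; case/andP: hy => y0 yr; rewrite mulr_gt0//=.
  by have := q1 j; have := q0 j; nra.
have p0 : p 0 = y by rewrite /p expr0 scale1r addrC subrK.
have s0E : s 0 = `|f y - f x| by rewrite /s p0.
have sM j : s j <= M * s j.+1.
  have := h1 _ (pr j); have -> : p j - x = (3 / 4) ^+ j *: (y - x).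
    by rewrite /p addrC addKr.
  by rewrite scalerA -exprS.
have spos j : 0 < s j by have [/andP[]] := hr _ (pr j).
(* If the images of [p 0] and [p l] are at comparable distances from [f x], moving back by g shows
   that |p 0 - x| is at most K |p l - x|. This fails for l at least n, as (4 / 3)^n exceeds K. *)
have key l : s 0 / 2 <= s l -> s l <= M * s 0 -> (l < n)%N.
  move=> a b; have S0 := spos 0%N; have Sl := spos l.
  have [hl gl] := hr _ (pr l); have [h0 g0] := hr _ (pr 0%N).
  have := annulus_close dimF M1 k1 hm h2 h0 hl.
  rewrite -/(s l) -/(s 0) gl g0 /k => /(_ _ _)[]; [nra|nra|move=> _].
  rewrite -/K => c; have := ler_distD (p l) (p 0%N) x; have [] := px l.
  move=> E1; have /andP[_ _] := pr l; have c' : `|p 0 - x| <= K * `|p l - x|.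
    have := ler_distD (p l) (p 0%N) x; lra.
  move=> _; rewrite ltnNge; apply/negP => nl; move: c'; rewrite !px expr0 mul1r.
  have y0 : 0 < `|y - x| by case/andP: hy.
  rewrite mulrA -[leLHS]mul1r ler_pM2r// leNgt => /negP; apply.
  have : K * (3 / 4) ^+ l <= K * (3 / 4) ^+ n.
    rewrite ler_pM2l; last by rewrite mulr_gt0// exprn_gt0//; lra.
    by rewrite ler_wiXn2l//; lra.
  move=> /le_lt_trans; apply.
  have -> : (3 / 4) ^+ n = ((4 / 3) ^+ n)^-1 :> R by rewrite -exprVn invf_div.
  by rewrite ltr_pdivrMr ?mul1r// exprn_gt0//; lra.
rewrite -/(p n) -/(s n) -s0E leNgt; apply/negP => bad.
(* Continuity at x makes the distances drop below half eventually. At the last index l before the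
   drop, [s l] is still above half of [s 0], and by [sM] at most M [s 0], contradicting [key]. *)
have ex : exists l, (n <= l)%N && (s l.+1 <= s 0 / 2).
  have S2 : 0 < s 0 / 2 by rewrite divr_gt0.
  have [d d0 Hd] := h3 _ S2.
  have [|j Hj] := @expr_gt_exists R (4 / 3) (`|y - x| / d); first lra.
  exists (n + j)%N; rewrite leq_addr /=; apply: Hd; rewrite px.
  have : (3 / 4) ^+ (n + j).+1 <= (3 / 4) ^+ j :> R.
    by apply: ler_wiXn2l; [lra|lra|rewrite leqW// leq_addl].
  have -> : (3 / 4) ^+ j = ((4 / 3) ^+ j)^-1 :> R by rewrite -exprVn invf_div.
  move=> hj; apply: (@le_trans _ _ (((4 / 3) ^+ j)^-1 * `|y - x|)).
    by rewrite ler_wpM2r.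
  rewrite mulrC ler_pdivrMr; last by rewrite exprn_gt0//; lra.
  by rewrite ltr_pdivrMr// in Hj; rewrite mulrC ltW.
case: (ex_minnP ex) => l /andP[nl sl] minl.
have sl' : s 0 / 2 < s l.
  have [->//|ln] := eqVneq l n; rewrite ltNge; apply/negP => h.
  have n_l : (n < l)%N by rewrite ltn_neqAle eq_sym ln.
  case: l n_l {nl sl ln} minl h => // l n_l minl h.
  by have := minl l; rewrite -ltnS n_l h ltnn => /(_ isT).
have : (l < n)%N.
  apply: key; first exact: ltW.
  apply: le_trans (sM l) _; rewrite ler_pM2l; last lra.
  by apply: le_trans sl _; have := spos 0%N; lra.
by rewrite ltnNge nl.
Qed.

(** Boundary points other than x are at distance at least r from x. With the reverse inequality in
    the next lemma, the distance to the boundary near the puncture is exactly the distance to x. *)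
Lemma le_bdist_punctured (R : realType) (E : normedModType R) (A : set E)
    (x u : E) (r : R) :
  proper_domain A -> punctured_ball x r `<=` A -> `|u - x| <= r / 2 ->
  `|u - x| <= bdist A u.
Proof.
move=> pA sub ur; apply: le_bdist => // w _ nw.
have [->//|wx] := eqVneq w x.
have : r <= `|w - x|.
  rewrite leNgt; apply/negP => wr; apply: nw; apply: sub.
  by rewrite /punctured_ball /= normr_gt0 subr_eq0 wx.
have := ler_distD u w x; rewrite (distrC w u); lra.
Qed.

Lemma bdist_punctured_le (R : realType) (E : normedModType R) (A : set E)
    (x u : E) (r : R) : dim_ge2 E -> 0 < r ->
  proper_domain A -> punctured_ball x r `<=` A -> ~ A x ->
  bdist A u <= `|u - x|.
Proof.
move=> dimE r0 pA sub nAx; apply: bdist_le => //; apply/closure_normP => e e0.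
have [|y yx] := @punctured_ball_arbitrarily_small _ _ x (Num.min e r) dimE.
  by rewrite lt_min e0.
rewrite lt_min => /andP[ye yr]; exists y => //; apply: sub.
by rewrite /punctured_ball /= normr_gt0 subr_eq0 yx distrC.
Qed.

(* A local Hölder estimate with exponent [1 / N], raised to the power [N]. *)
Lemma local_holder (R : realType) (phi : R -> R) :
  homeo (`[0, +oo[ : set R) (`[0, +oo[ : set R) phi ->
  (forall t : R, 0 <= t -> t <= phi t) ->
  exists (tau C0 : R) (N : nat), [/\ 0 < tau <= 1 / 4, 0 < C0, (0 < N)%N &
    forall (E F : normedModType R) (D : set E) (D' : set F) f g,
    dim_ge2 E -> dim_ge2 F -> domain D -> mutually_inverse D D' f g ->
    FQ_steps phi D f g ->
    forall x y, D x -> `|y - x| <= tau * bdist D x ->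
      `|f y - f x| ^+ N * bdist D x <= C0 * `|y - x| * bdist D' (f x) ^+ N].
Proof.
move=> hphi phi_ge.
have [M M1 HM] := distortion_bounded hphi phi_ge.
(* The factor 3 / 2 makes g map the ball of radius t1 d' about [f x] into the ball of radius d / 2
   about x; with 1 + t1 / 2, the map f sends the ball of radius t2 d into the ball of radius t1 d' /
   2. *)
have [|t1 /andP[t10 t14] Ht1] := @distortion_small _ _ hphi phi_ge (3 / 2); first lra.
have [|t2 /andP[t20 t24] Ht2] := @distortion_small _ _ hphi phi_ge (1 + t1 / 2); first lra.
have [n n0 decay] := punctured_decay M1.
have HM4 s : 0 <= s <= 3 * (1 / 4) -> phi s <= ln M.
  by move=> hs; apply: HM; lra.
have M10 : 0 <= M - 1 by lra.
have q0 : 0 < 3 / 4 :> R by lra.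
have q0' := ltW q0.
have q1 : 3 / 4 <= 1 :> R by lra.
have q43 : 3 / 4 * (4 / 3) = 1 :> R by lra.
have quarter : 0 <= (1 / 4 : R) <= 1 / 4 by apply/andP; split; lra.
pose La : R := (4 / 3) ^+ n.
have La1 : 1 < La by rewrite exprn_egt1 -?lt0n//; lra.
(* Shrinking the distance to x by the factor [La] halves the distance of the images; since 2^N
   exceeds [La], this is Hölder continuity with exponent 1 / N. *)
have [|N HN] := @expr_gt_exists R 2 La; first lra.
have N0 : (0 < N)%N.
  by case: N HN => //; rewrite expr0 ltNge ltW.
exists t2, (2 ^+ N / t2), N; split => //; first by rewrite t20.
  by rewrite divr_gt0// exprn_gt0.
move=> E F D D' f g dimE dimF dD [fg gf] FQ x y Dx yx.
have fDE : f @` D = D'.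
  rewrite eqEsubset; split=> [_ [z Dz <-]|u D'u]; first exact: (fg z Dz).1.
  by exists (g u); [exact: (gf u D'u).1|exact: (gf u D'u).2].
have [pD pD' st st'] := FQ D dD (@subset_refl _ D); rewrite fDE in pD' st st'.
have D'x := (fg x Dx).1; have gx := (fg x Dx).2.
set d := bdist D x in yx *; set d' := bdist D' (f x).
have d0 : 0 < d by exact: bdist_gt0.
have d'0 : 0 < d' by exact: bdist_gt0.
have inD z : `|z - x| < d -> D z by rewrite distrC; exact: bdist_ball.
have inD' u : `|u - f x| < d' -> D' u by rewrite distrC; exact: bdist_ball.
have S (t e : R) : 0 < t -> t <= 1 / 4 -> 0 < e ->
    (forall s, 0 <= s <= 3 * t -> phi s <= ln (1 + e)) ->
    forall z, `|z - x| <= t * d -> `|f z - f x| <= e * d'.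
  move=> t0 t4 e0 He z zx; have Dz : D z by apply: inD; apply: le_lt_trans zx _; nra.
  have [||| h _] := st t (1 + e) _ _ He x z Dx Dz; [lra|lra|by rewrite distrC|].
  by rewrite [1 + e]addrC addrK distrC in h.
have S2 u : `|u - f x| <= t1 * d' -> D' u /\ `|g u - x| <= d / 2.
  move=> ux; have D'u : D' u by apply: inD'; apply: le_lt_trans ux _; nra.
  split => //.
  have [||| h _] := st' t1 (3 / 2) _ _ Ht1 (f x) u D'x D'u; [lra|lra|by rewrite distrC|].
  by rewrite gx distrC -/d in h; lra.
(* On G1 and its image the deleted points become boundary points, so a step of relative length 1 / 4
   is measured against the distance to x or to [f x]. *)
pose G1 := punctured_ball x d; pose H1 := f @` G1.
have G1D : G1 `<=` D by move=> z /andP[_]; exact: inD.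
have [pG1 pH1 s1 s2] := FQ G1 (domain_punctured_ball x dimE d0) G1D.
rewrite -/H1 in pH1 s1 s2.
have subH : punctured_ball (f x) (t1 * d') `<=` H1.
  move=> u /andP[u0 ur]; have [D'u gux] := S2 u (ltW ur).
  exists (g u); last exact: (gf u D'u).2.
  rewrite /G1 /punctured_ball /= (le_lt_trans gux) ?andbT; last lra.
  rewrite normr_gt0 subr_eq0; apply: contraTN u0 => /eqP gux0.
  by rewrite -[u](gf u D'u).2 gux0 subrr normr0 ltxx.
have nG1 : ~ G1 x by rewrite /G1 /punctured_ball /= subrr normr0 ltxx.
have inj z : D z -> f z = f x -> z = x.
  by move=> Dz fz; rewrite -(fg z Dz).2 fz gx.
have nH1 : ~ H1 (f x) by move=> [z G1z] /(inj _ (G1D _ G1z)) zx; rewrite zx in G1z.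
have t1d' : 0 < t1 * d' by rewrite mulr_gt0.
have decay' := @decay E F f g x (t2 * d) (t1 / 2 * d') dimF _ _ _ _.
have h0 z : 0 < `|z - x| <= t2 * d ->
    0 < `|f z - f x| <= t1 / 2 * d' /\ g (f z) = z.
  move=> /andP[z0 zr]; have Dz : D z by apply: inD; apply: le_lt_trans zr _; nra.
  split; last exact: (fg z Dz).2.
  rewrite (S t2 (t1 / 2))// ?andbT; last by rewrite divr_gt0.
  rewrite normr_gt0 subr_eq0; apply: contraTN z0 => /eqP /(inj z Dz) ->.
  by rewrite subrr normr0 ltxx.
have h1 z : 0 < `|z - x| <= t2 * d ->
    `|f z - f x| <= M * `|f (x + (3 / 4) *: (z - x)) - f x|.
  move=> /andP[z0 zr]; set w := x + _.
  have wx : `|w - x| = 3 / 4 * `|z - x|.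
    by rewrite /w addrC addKr normrZ ger0_norm//; lra.
  have zw : `|z - w| = 1 / 4 * `|z - x|.
    have -> : z - w = (1 / 4) *: (z - x).
      have -> : (1 / 4 : R) = 1 - 3 / 4 by lra.
      by rewrite scalerBl scale1r /w opprD addrA.
    by rewrite normrZ ger0_norm//; lra.
  have zd : `|z - x| <= d / 2 by nra.
  have G1z : G1 z by rewrite /G1 /punctured_ball /= z0 /=; lra.
  have G1w : G1 w by rewrite /G1 /punctured_ball /= wx; apply/andP; split; lra.
  have [|_] := s1 (1 / 4) M quarter M1 HM4 z w G1z G1w.
    have : `|z - x| <= bdist G1 z by exact: le_bdist_punctured pG1 (@subset_refl _ G1) zd.
    by rewrite zw ler_pM2l//; lra.
  have := bdist_punctured_le (f w) dimF t1d' pH1 subH nH1.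
  have := ler_distD (f w) (f z) (f x); nra.
have h2 u v : 0 < `|u - f x| <= t1 / 2 * d' -> 0 < `|v - f x| <= t1 / 2 * d' ->
    `|u - v| <= `|u - f x| / 4 -> close (fun z => `|z - x|) M (g u) (g v).
  move=> /andP[u0 ur] /andP[v0 vr] uv.
  have H1u : H1 u by apply: subH; rewrite /punctured_ball /= u0 /=; nra.
  have H1v : H1 v by apply: subH; rewrite /punctured_ball /= v0 /=; nra.
  have [|c1 c2] := s2 (1 / 4) M quarter M1 HM4 u v H1u H1v.
    have : `|u - f x| <= bdist H1 u by apply: le_bdist_punctured pH1 subH _; lra.
    lra.
  split; [apply: le_trans c1 _|apply: le_trans c2 _]; rewrite ler_wpM2l//;
    exact: bdist_punctured_le dimE d0 pG1 (@subset_refl _ G1) nG1.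
have h3 e : 0 < e -> exists2 del, 0 < del & forall z, `|z - x| <= del ->
    `|f z - f x| <= e.
  move=> e0; have ed : 0 < e / d' by rewrite divr_gt0.
  have [|t /andP[t0 t4] Ht] := @distortion_small _ _ hphi phi_ge (1 + e / d').
    by rewrite ltrDl.
  exists (t * d) => [|z zx]; first by rewrite mulr_gt0.
  by rewrite (le_trans (S t _ t0 t4 ed Ht z zx))// divfK// gt_eqF.
have {}decay := decay' h0 h1 h2 h3.
have [->|yx0] := eqVneq y x.
  by rewrite !subrr !normr0 expr0n gtn_eqF// mul0r mulr0 mul0r.
have ny : 0 < `|y - x| by rewrite normr_gt0 subr_eq0.
have iter z j : 0 < `|z - x| <= t2 * d ->
    `|f (x + ((3 / 4) ^+ n) ^+ j *: (z - x)) - f x| <= `|f z - f x| / 2 ^+ j.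
  move=> hz; elim: j => [|j ih].
    by rewrite !expr0 scale1r divr1 (addrC x) subrK.
  set w := x + ((3 / 4) ^+ n) ^+ j *: (z - x) in ih.
  have wx : w - x = ((3 / 4) ^+ n) ^+ j *: (z - x) by rewrite /w addrC addKr.
  have hw : 0 < `|w - x| <= t2 * d.
    have c0 : 0 < ((3 / 4) ^+ n) ^+ j :> R by rewrite !exprn_gt0.
    have c1 : ((3 / 4) ^+ n) ^+ j <= 1 :> R.
      by rewrite exprn_ile1// ?exprn_ge0 ?exprn_ile1.
    rewrite wx normrZ gtr0_norm//; case/andP: hz => z0 zr.
    by rewrite mulr_gt0//= (le_trans _ zr)// ler_piMl// ltW.
  have := decay w hw; rewrite wx scalerA -exprS.
  have : 0 < 2 ^+ j :> R by rewrite exprn_gt0.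
  move=> p2 h; apply: le_trans h _; rewrite exprSr invfM mulrA.
  by rewrite ler_pM2r// invr_gt0.
(* The point y is pushed away from x along its ray by [La]^k, with k as large as the radius t2 d
   allows; the halving is then iterated k times from the resulting point z. *)
have ex : exists k, t2 * d < La ^+ k.+1 * `|y - x|.
  have [k Hk] := expr_gt_exists (t2 * d / `|y - x|) La1.
  exists k; rewrite -ltr_pdivrMr//; apply: lt_le_trans Hk _.
  by rewrite ler_eXn2l.
case: (ex_minnP ex) => k hk mink.
have Lak0 j : 0 < La ^+ j by rewrite exprn_gt0// (lt_trans ltr01).
have kr : La ^+ k * `|y - x| <= t2 * d.
  case: k hk mink => [|k] hk mink; first by rewrite expr0 mul1r.
  by rewrite leNgt; apply/negP => /mink; rewrite ltnn.
pose z := x + La ^+ k *: (y - x).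
have zx : z - x = La ^+ k *: (y - x) by rewrite /z addrC addKr.
have hz : 0 < `|z - x| <= t2 * d.
  by rewrite zx normrZ gtr0_norm// kr mulr_gt0.
have := iter z k hz; rewrite zx scalerA.
have -> : ((3 / 4) ^+ n) ^+ k * La ^+ k = 1 :> R.
  by rewrite /La -exprMn -exprMn q43 !expr1n.
rewrite scale1r (addrC x) subrK => sy.
have [/andP[_ fz] _] := h0 z hz.
have {sy} sy : `|f y - f x| <= 2 * d' / 2 ^+ k.+1.
  have p2 : 0 < 2 ^+ k :> R by rewrite exprn_gt0.
  apply: le_trans sy _; rewrite exprS invfM mulrA -[2 * d' / 2]mulrAC divff// mul1r.
  by rewrite ler_pM2r ?invr_gt0//; nra.
have : `|f y - f x| ^+ N <= (2 * d' / 2 ^+ k.+1) ^+ N.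
  by rewrite lerXn2r ?nnegrE// !mulr_ge0// ?invr_ge0 ?exprn_ge0// ltW.
rewrite expr_div_n -exprM mulnC exprM => h.
have : (2 * d') ^+ N / (2 ^+ N) ^+ k.+1 <= (2 * d') ^+ N / La ^+ k.+1.
  rewrite ler_pM2l; last by rewrite exprn_gt0// mulr_gt0.
  rewrite lef_pV2 ?posrE ?Lak0 ?exprn_gt0//.
  by rewrite lerXn2r ?nnegrE ?(ltW HN) ?exprn_ge0// ltW// (lt_trans ltr01).
move=> /(le_trans h) {}h.
apply: le_trans (ler_wpM2r (ltW d0) h) _.
set P := La ^+ k.+1 in hk *; have P0 : 0 < P by exact: Lak0.
have dP : d / P <= `|y - x| / t2.
  by rewrite ler_pdivrMr// mulrAC ler_pdivlMr// mulrC (mulrC _ P) ltW.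
have -> : 2 ^+ N / t2 * `|y - x| * d' ^+ N = (2 * d') ^+ N * (`|y - x| / t2).
  by rewrite exprMn; field; rewrite gt_eqF.
by rewrite mulrAC -mulrA ler_wpM2l// exprn_ge0// mulr_ge0// ltW.
Qed.

(** * Summation along uniform arcs *)

Section half_arc.
Context {R : realType} {E : normedModType R}.
Implicit Types (D : set E) (c a T : R) (g : R -> E) (s : R -> R).

(* Half of a uniform arc: [s] stands for the length from the starting point. *)
Definition half_arc c D a T g s : Prop :=
  [/\ a <= T, {within `[a, T], continuous g}, s a = 0,
    forall t u, a <= t -> t <= u -> u <= T -> `|g t - g u| <= s u - s t
    & forall t, a <= t <= T -> D (g t) /\
        (t < T -> s t <= c * bdist D (g t))].

Lemma bdist_half_arc_le c D a T g s t : proper_domain D ->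
  half_arc c D a T g s -> a <= t <= T ->
  bdist D (g t) <= bdist D (g a) + s t.
Proof.
move=> pD [aT _ sa gs _] /andP[at_ tT].
have := bdist_lip (g t) (g a) pD; have := gs a t (lexx _) at_ tT.
by rewrite distrC sa subr0; lra.
Qed.

(* Consecutive points at distance a quarter of the distance to the boundary:
   the potential [bdist D (g a) + s t] grows at least geometrically. *)
Lemma half_arc_ind c D a T g s (P : R -> Prop) : 0 <= c -> proper_domain D ->
  half_arc c D a T g s ->
  P T ->
  (forall t, a <= t < T -> `|g t - g T| <= bdist D (g t) / 4 -> P t) ->
  (forall t u, a <= t -> t < u -> u <= T -> `|g t - g u| <= bdist D (g t) / 4 ->
    (1 + (4 * (1 + 2 * c))^-1) * (bdist D (g a) + s t) <= bdist D (g a) + s u ->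
    P u -> P t) ->
  P a.
Proof.
move=> c0 pD ha PT Pbase Pstep; have [aT cg sa gs gD] := ha.
set p0 := bdist D (g a) in Pstep *.
have p00 : 0 < p0.
  by apply: bdist_gt0 => //; have [] := gD a; rewrite ?lexx.
have c1 : 0 < 4 * (1 + 2 * c) by lra.
(* A lower bound for the increase of [s] in one step, which makes the number of steps finite. *)
pose m := p0 / (4 * (1 + 2 * c)); have m0 : 0 < m by rewrite divr_gt0.
suff H n t : a <= t <= T -> s T - s t <= n%:R * m -> P t.
  apply: (H (Num.truncn ((s T - s a) / m)).+1); rewrite ?lexx//.
  by rewrite -ler_pdivrMr// ltW// truncnS_gt.
elim: n t => [|n ih] t /andP[at_ tT] hs.
  have [->//|tT'] := eqVneq t T.
  have {}tT' : t < T by rewrite lt_neqAle tT'.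
  apply: Pbase; first by rewrite at_.
  have [Dt _] := gD t (introT andP (conj at_ tT)).
  by have := bdist_gt0 pD Dt; have := gs t T at_ tT (lexx _); lra.
have [->//|tT'] := eqVneq t T.
have {}tT' : t < T by rewrite lt_neqAle tT'.
have [Dt /(_ tT') st] := gD t (introT andP (conj at_ tT)).
have d0 := bdist_gt0 pD Dt.
have [h|h] := leP `|g t - g T| (bdist D (g t) / 4).
  by apply: Pbase => //; rewrite at_.
have [u] : exists2 u, u \in `[t, T] & `|g t - g u| = bdist D (g t) / 4.
  apply: IVT => //.
    apply/within_continuousP => r hr e e0.
    have [|d dd Hd] := (within_continuousP _ _).1 cg r _ e e0.
      by rewrite /= in_itv /= (itvP hr) (le_trans at_)// (itvP hr).
    exists d => // q hq rq; have := Hd q _ rq.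
    rewrite /= in_itv /= (itvP hq) (le_trans at_) ?(itvP hq)// => /(_ isT).
    apply: le_lt_trans; apply: le_trans (ler_dist_dist _ _) _.
    by rewrite opprB addrC subrKA distrC.
  rewrite subrr normr0 ge_min le_max; apply/andP; split; apply/orP; [left|right]; lra.
rewrite in_itv /= => /andP[tu uT] gu.
have {}tu : t < u.
  rewrite lt_neqAle tu andbT; apply: contra_eqN gu => /eqP <-.
  by rewrite subrr normr0 eq_sym gt_eqF// divr_gt0.
have su := gs t u at_ (ltW tu) uT; rewrite gu in su.
(* The potential is at most [bdist D (g t)] + 2 s t, and s t is at most c [bdist D (g t)]. A step of
   length [bdist D (g t)] / 4 therefore adds at least the fraction 1 / (4 (1 + 2 c)) of the
   potential. *)
have pd : p0 + s t <= (1 + 2 * c) * bdist D (g t).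
  have := bdist_lip (g a) (g t) pD; have := gs a t (lexx _) at_ tT.
  by rewrite sa -/p0; nra.
have st0 : 0 <= s t by have := gs a t (lexx _) at_ tT; have := normr_ge0 (g a - g t); lra.
have gain : (p0 + s t) / (4 * (1 + 2 * c)) <= bdist D (g t) / 4.
  by rewrite ler_pdivrMr// (_ : _ / 4 * _ = (1 + 2 * c) * bdist D (g t))//; field.
apply: (Pstep t u) => //; first by rewrite gu.
  rewrite mulrDl mul1r [_^-1 * _]mulrC; lra.
apply: ih; first by rewrite uT (le_trans at_)// ltW.
have : m <= (p0 + s t) / (4 * (1 + 2 * c)).
  by rewrite ler_pM2r ?invr_gt0//; lra.
by rewrite -natr1 mulrDl mul1r in hs; lra.
Qed.

(** Each step costs a factor [M], at most the power [B] of the growth of the potential. The product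
    telescopes to the power [B] of the total growth, and the leading [M] pays for the last,
    incomplete step. *)
Lemma close_half_arc (F : normedModType R) (f : E -> F) (d : F -> R) (M : R)
    (B : nat) c D a T g s :
  0 <= c -> 1 <= M -> M <= (1 + (4 * (1 + 2 * c))^-1) ^+ B ->
  lip1 d -> (forall x, D x -> 0 <= d (f x)) -> proper_domain D ->
  (forall x y, D x -> D y -> `|x - y| <= bdist D x / 4 ->
    close d M (f x) (f y)) ->
  half_arc c D a T g s ->
  close d (M * (1 + s T / bdist D (g a)) ^+ B) (f (g a)) (f (g T)).
Proof.
move=> c0 M1 MB ld d0 pD step ha; have [aT cg sa gs gD] := ha.
set p0 := bdist D (g a).
have Da : D (g a) by have [] := gD a; rewrite ?lexx.
have p00 : 0 < p0 by exact: bdist_gt0.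
pose p t := p0 + s t.
have pge t : a <= t <= T -> p0 <= p t.
  move=> /andP[h1 h2]; have := gs a t (lexx _) h1 h2; have := normr_ge0 (g a - g t).
  by rewrite /p; lra.
have pT t : a <= t <= T -> p t <= p T.
  move=> /andP[h1 h2]; have := gs t T h1 h2 (lexx _); have := normr_ge0 (g t - g T).
  by rewrite /p; lra.
have -> : 1 + s T / p0 = p T / p a.
  by rewrite /p sa addr0 mulrDl divff// gt_eqF.
have aT' : a <= T <= T by rewrite aT lexx.
have Tge t : a <= t <= T -> 1 <= (p T / p t) ^+ B.
  move=> ht; rewrite exprn_ege1// ler_pdivlMr; first by rewrite mul1r pT.
  exact: lt_le_trans (pge t ht).
apply: (half_arc_ind (P := fun t =>
  close d (M * (p T / p t) ^+ B) (f (g t)) (f (g T))) c0 pD ha).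
- have dT := d0 _ (gD T aT').1; have h := Tge T aT'.
  by rewrite /close subrr normr0; split; rewrite mulr_ge0// subr_ge0 mulr_ege1.
- move=> t /andP[at_ tT] h.
  have ht : a <= t <= T by rewrite at_ ltW.
  apply: (@close_mono _ _ _ M); [exact: d0 (gD t ht).1|exact: d0 (gD T aT').1| |].
    by rewrite ler_peMr ?Tge// (le_trans ler01).
  by apply: step => //; [exact: (gD t ht).1|exact: (gD T aT').1].
move=> t u at_ tu uT tgu pu Pu.
have ht : a <= t <= T by rewrite at_ (le_trans (ltW tu)).
have hu : a <= u <= T by rewrite uT (le_trans at_ (ltW tu)).
apply: (@close_mono _ _ _ (M * (M * (p T / p u) ^+ B))).
- exact: d0 (gD t ht).1.
- exact: d0 (gD T aT').1.
- have pt0 : 0 < p t by apply: lt_le_trans p00 (pge t ht).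
  have pu0 : 0 < p u by apply: lt_le_trans p00 (pge u hu).
  rewrite ler_pM2l; last lra.
  have -> : p T / p t = p u / p t * (p T / p u) by field; rewrite !gt_eqF.
  rewrite [leRHS]exprMn ler_wpM2r//; first by rewrite (le_trans ler01)// Tge.
  apply: le_trans MB _; rewrite lerXn2r ?nnegrE//.
  + by rewrite addr_ge0// invr_ge0; lra.
  + by rewrite divr_ge0 ?(ltW pu0) ?(ltW pt0).
  + by rewrite ler_pdivlMr.
apply: close_trans Pu => //.
  by rewrite mulr_ege1// Tge.
by apply: step => //; [exact: (gD t ht).1|exact: (gD u hu).1].
Qed.

(** The costs are dominated by powers [alpha] of a geometrically growing potential: with mu the
    growth of these powers minus 1, each cost is at most their increment divided by mu, and the
    increments telescope. *)
Lemma sum_half_arc (F : normedModType R) (f : E -> F) (h : E -> R)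
    (M A alpha : R) c D a T g s :
  0 <= c -> 0 <= M -> 0 <= A -> 0 < alpha -> proper_domain D ->
  (forall x y, D x -> D y -> `|x - y| <= bdist D x / 4 ->
    `|f x - f y| <= M * h x) ->
  half_arc c D a T g s ->
  (forall t, a <= t <= T -> h (g t) <= A * bdist D (g t) `^ alpha) ->
  `|f (g a) - f (g T)| <=
    M * A * (1 + ((1 + (4 * (1 + 2 * c))^-1) `^ alpha - 1)^-1) *
    (bdist D (g a) + s T) `^ alpha.
Proof.
move=> c0 M0 A0 al0 pD step ha hA; have [aT cg sa gs gD] := ha.
set p0 := bdist D (g a).
have Da : D (g a) by have [] := gD a; rewrite ?lexx.
have p00 : 0 < p0 by exact: bdist_gt0.
pose p t := p0 + s t; rewrite -/(p T).
have pge t : a <= t <= T -> p0 <= p t.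
  move=> /andP[h1 h2]; have := gs a t (lexx _) h1 h2; have := normr_ge0 (g a - g t).
  by rewrite /p; lra.
have pT t : a <= t <= T -> p t <= p T.
  move=> /andP[h1 h2]; have := gs t T h1 h2 (lexx _); have := normr_ge0 (g t - g T).
  by rewrite /p; lra.
have mono (x y : R) : 0 <= x -> x <= y -> x `^ alpha <= y `^ alpha.
  move=> x0 xy; apply: ge0_ler_powR; rewrite ?nnegrE ?(ltW al0)//.
  exact: le_trans xy.
set lam := 1 + (4 * _)^-1; set mu := lam `^ alpha - 1.
have lam1 : 1 < lam by rewrite ltrDl invr_gt0; lra.
have mu0 : 0 < mu.
  have al1 : 1 `^ alpha = 1 :> R by rewrite powR1.
  rewrite subr_gt0 -[X in X < _]al1.
  by apply: gt0_ltr_powR; rewrite ?nnegrE// ltW// (lt_trans ltr01).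
have aT' : a <= T <= T by rewrite aT lexx.
have MA0 : 0 <= M * A by rewrite mulr_ge0.
have cost t u : a <= t <= T -> a <= u <= T ->
    `|g t - g u| <= bdist D (g t) / 4 ->
    `|f (g t) - f (g u)| <= M * A * p t `^ alpha.
  move=> ht hu gtu; apply: le_trans (step _ _ (gD t ht).1 (gD u hu).1 gtu) _.
  rewrite -mulrA ler_wpM2l//; apply: le_trans (hA t ht) _; rewrite ler_wpM2l// mono//.
    by rewrite ltW// bdist_gt0//; exact: (gD t ht).1.
  exact: bdist_half_arc_le ha ht.
suff : `|f (g a) - f (g T)| <=
    M * A * (p T `^ alpha + (p T `^ alpha - p a `^ alpha) / mu).
  move=> /le_trans; apply; rewrite -[leRHS]mulrA ler_wpM2l//.
  rewrite [leRHS]mulrDl mul1r lerD2l [leLHS]mulrC.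
  rewrite ler_wpM2l ?invr_ge0 ?(ltW mu0)// gerBl.
  exact: powR_ge0.
apply: (half_arc_ind (P := fun t => `|f (g t) - f (g T)| <=
  M * A * (p T `^ alpha + (p T `^ alpha - p t `^ alpha) / mu)) c0 pD ha).
- by rewrite !subrr normr0 mul0r addr0 mulr_ge0// powR_ge0.
- move=> t /andP[at_ tT] gtT; have ht : a <= t <= T by rewrite at_ ltW.
  apply: le_trans (cost t T ht aT' gtT) _; rewrite ler_wpM2l//.
  have pp : p t `^ alpha <= p T `^ alpha.
    by apply: mono (pT t ht); exact: le_trans (ltW p00) (pge t ht).
  by apply: (le_trans pp); rewrite lerDl divr_ge0 ?(ltW mu0)// subr_ge0.
move=> t u at_ tu uT tgu pu Pu.
have ht : a <= t <= T by rewrite at_ (le_trans (ltW tu)).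
have hu : a <= u <= T by rewrite uT (le_trans at_ (ltW tu)).
apply: le_trans (ler_distD (f (g u)) _ _) _.
have c1 := cost t u ht hu tgu.
have pt0 : 0 <= p t by exact: le_trans (ltW p00) (pge t ht).
have key : p t `^ alpha <= (p u `^ alpha - p t `^ alpha) / mu.
  rewrite ler_pdivlMr// /mu mulrBr mulr1 lerD2r -powRM//; last lra.
  by apply: mono; rewrite ?mulr_ge0 1?mulrC//; lra.
have -> : p T `^ alpha + (p T `^ alpha - p t `^ alpha) / mu =
    (p u `^ alpha - p t `^ alpha) / mu +
    (p T `^ alpha + (p T `^ alpha - p u `^ alpha) / mu).
  by rewrite [RHS]addrCA -mulrDl; congr (_ + _ / _); ring.
rewrite mulrDr; apply: lerD Pu.
by apply: (le_trans c1); rewrite ler_wpM2l.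
Qed.

(** The arc is cut at the supremum T of the parameters where the length from x is at most the length
    to y. The length bound is asserted only before T, since T itself may fall on either side. The
    second half is run backwards, by the parameter - t. *)
Lemma uniform_halves c D x y : uniform_domain c D -> D x -> D y ->
  exists a1 T1 g1 s1 a2 T2 g2 s2,
  [/\ half_arc c D a1 T1 g1 s1, half_arc c D a2 T2 g2 s2,
    [/\ g1 a1 = x, g2 a2 = y & g1 T1 = g2 T2],
    s1 T1 <= c * `|x - y| /\ s2 T2 <= c * `|x - y|
  & forall z, (exists2 t, a1 <= t <= T1 & g1 t = z) \/
              (exists2 t, a2 <= t <= T2 & g2 t = z) ->
      Num.min `|z - x| `|z - y| <= c * bdist D z].
Proof.
move=> [pD uD] Dx Dy.
have [a [b [g [[[ab cg _] ga gb gD] lfin cone lle]]]] := uD x y Dx Dy.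
pose s t := fine (arc_length a t g); pose r t := fine (arc_length t b g).
have sfin t : a <= t <= b -> arc_length a t g = (s t)%:E.
  move=> /andP[at_ tb]; rewrite fineK// ge0_fin_numE ?arc_length_ge0//.
  apply: le_lt_trans lfin; apply: le_trans (arc_length_prefix g at_ tb).
  by rewrite leeDl// lee_fin.
have rfin t : a <= t <= b -> arc_length t b g = (r t)%:E.
  move=> /andP[at_ tb]; rewrite fineK// ge0_fin_numE ?arc_length_ge0//.
  apply: le_lt_trans lfin; apply: le_trans (arc_length_suffix g at_ tb).
  by rewrite leeDr// lee_fin.
have sinc t u : a <= t -> t <= u -> u <= b -> `|g t - g u| <= s u - s t.
  move=> at_ tu ub; have := arc_length_prefix g at_ tu.
  rewrite !sfin ?at_ ?ub ?(le_trans at_ tu) ?(le_trans tu ub)// -EFinD lee_fin distrC; lra.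
have rdec t u : a <= t -> t <= u -> u <= b -> `|g t - g u| <= r t - r u.
  move=> at_ tu ub; have := arc_length_suffix g tu ub.
  rewrite !rfin ?at_ ?ub ?(le_trans at_ tu) ?(le_trans tu ub)// -EFinD lee_fin distrC; lra.
have arcxx t : arc_length t t g = 0%E.
  apply/le_anti; rewrite arc_length_ge0// andbT; apply: ge_ereal_sup => _ [l pl <-].
  by rewrite (itv_partitionxx pl) polygon_length_nil.
have sa : s a = 0 by rewrite /s arcxx.
have rb : r b = 0 by rewrite /r arcxx.
have cone' t : a <= t <= b -> Num.min (s t) (r t) <= c * bdist D (g t).
  move=> ht; have := cone t; rewrite in_itv /= ht => /(_ isT).
  by rewrite sfin// rfin// -EFin_min lee_fin.
have lab : s b <= c * `|x - y| by rewrite -lee_fin -sfin ?ab ?lexx.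
have rab : r a <= c * `|x - y| by rewrite -lee_fin -rfin ?ab ?lexx.
pose S := [set t | a <= t <= b /\ s t <= r t].
have Sa : S a.
  split; first by rewrite lexx ab.
  by rewrite sa /r fine_ge0// arc_length_ge0.
have hS : has_sup S by split; [exists a|exists b => t [/andP[]]].
set T := sup S.
have aT : a <= T by exact: ub_le_sup hS.2 _ Sa.
have Tb : T <= b by apply: ge_sup; [exists a|move=> t [/andP[]]].
have below t : a <= t < T -> s t <= c * bdist D (g t).
  move=> /andP[at_ tT]; have [|u [/andP[au ub] su] tu] := sup_adherent (eps := T - t) _ hS.
    by rewrite subr_gt0.
  rewrite subKr in tu.
  have htb : a <= t <= b by rewrite at_ (le_trans (ltW tu)).
  have := cone' t htb; rewrite min_l//.
  have := sinc t u at_ (ltW tu) ub; have := rdec t u at_ (ltW tu) ub.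
  have := normr_ge0 (g t - g u); lra.
have above t : T < t <= b -> r t <= c * bdist D (g t).
  move=> /andP[Tt tb]; have at_ : a <= t by exact: le_trans aT (ltW Tt).
  have := cone' t; rewrite at_ tb => /(_ isT); rewrite min_r// leNgt.
  apply/negP => /ltW sr; suff : t <= T by rewrite leNgt Tt.
  by apply: ub_le_sup hS.2 _ _; split => //; rewrite at_ tb.
exists a, T, g, s, (- b), (- T), (fun t => g (- t)), (fun t => r (- t)).
split.
- split => //.
  + apply: continuous_subspaceW cg => t /=; rewrite !in_itv /= => /andP[-> h].
    exact: le_trans h Tb.
  + by move=> t u at_ tu uT; apply: sinc => //; exact: le_trans Tb.
  + move=> t /andP[at_ tT]; split; last by move=> tT'; apply: below; rewrite at_.
    by apply: gD; exists t => //=; rewrite in_itv /= at_ (le_trans tT).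
- split => //.
  + by rewrite lerN2.
  + apply/within_continuousP => t; rewrite /= in_itv /= => /andP[h1 h2] e e0.
    have [|d d0 Hd] := (within_continuousP _ _).1 cg (- t) _ e e0.
      by rewrite /= in_itv /=; apply/andP; split; lra.
    exists d => // u; rewrite /= in_itv /= => /andP[h3 h4] tu; apply: Hd.
      by rewrite /= in_itv /=; apply/andP; split; lra.
    by rewrite -opprD normrN.
  + by rewrite opprK.
  + by move=> t u h1 h2 h3; rewrite distrC; apply: rdec; lra.
  + move=> t /andP[h1 h2]; split; last by move=> h; apply: above; apply/andP; split; lra.
    by apply: gD; exists (- t) => //=; rewrite in_itv /=; apply/andP; split; lra.
- by split => //; rewrite opprK.
- rewrite opprK; split.
    apply: le_trans lab; have := sinc T b aT Tb (lexx _); have := normr_ge0 (g T - g b); lra.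
  apply: le_trans rab; have := rdec a T (lexx _) aT Tb; have := normr_ge0 (g a - g T); lra.
have mincone t : a <= t <= b -> Num.min `|g t - x| `|g t - y| <= c * bdist D (g t).
  move=> /[dup] ht /andP[at_ tb]; apply: le_trans (cone' t ht).
  rewrite le_min !ge_min -ga -gb; have := sinc a t (lexx _) at_ tb.
  rewrite sa subr0 distrC => ->; have := rdec t b at_ tb (lexx _).
  by rewrite rb subr0 => ->; rewrite orbT.
move=> z [[t /andP[h1 h2] <-]|[t /andP[h1 h2] <-]]; apply: mincone.
  by rewrite h1 (le_trans h2).
by apply/andP; split; lra.
Qed.

(** A point of the arc at distance |x - y| / 2 from x is at least as far from y, so both parts of
    the arc are at least this long. *)
Lemma uniform_center c D x y : uniform_domain c D -> D x -> D y ->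
  exists2 z, D z & `|x - y| <= 2 * c * bdist D z.
Proof.
move=> [pD uD] Dx Dy.
have [a [b [g [[[ab cg _] ga gb gD] lfin cone lle]]]] := uD x y Dx Dy.
have [t ht gt] : exists2 t, t \in `[a, b] & `|x - g t| = `|x - y| / 2.
  apply: IVT => //.
    apply/within_continuousP => r hr e e0.
    have [d dd Hd] := (within_continuousP _ _).1 cg r hr e e0.
    exists d => // q hq rq; apply: le_lt_trans (Hd q hq rq).
    by apply: le_trans (ler_dist_dist _ _) _; rewrite opprB addrC subrKA distrC.
  rewrite ga gb subrr normr0 ge_min le_max; have := normr_ge0 (x - y) => ?.
  by apply/andP; split; apply/orP; [left|right]; lra.
exists (g t); first by apply: gD; exists t.
have hy : `|x - y| / 2 <= `|y - g t|.
  have := ler_distD (g t) x y; rewrite gt (distrC (g t)); lra.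
have h : ((`|x - y| / 2)%:E <= (c * bdist D (g t))%:E)%E.
  apply: le_trans (cone t ht); rewrite le_min -[X in X%:E]gt {1}gt.
  apply/andP; split; rewrite -?gt.
    rewrite -ga distrC; apply: dist_arc_length; rewrite (itvP ht)//.
  apply: (@le_trans _ _ (`|y - g t|%:E)); first by rewrite lee_fin gt.
  by rewrite -gb; apply: dist_arc_length; rewrite (itvP ht).
by rewrite lee_fin in h; lra.
Qed.

End half_arc.

(** * Hölder estimates on bounded uniform domains *)

Section boundary_points.
Context {R : realType} {E : normedModType R}.
Implicit Types (D : set E) (Delta : R).

Lemma bdist_le_diam D Delta z : proper_domain D ->
  (forall x y, D x -> D y -> `|x - y| <= Delta) -> D z -> bdist D z <= Delta.
Proof.
move=> pD dD Dz; have [w bw] := ext_boundary_neq0 pD.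
have [cw nw] := (ext_boundary_fin w (let: And3 _ h _ := pD.1 in h)).1 bw.
apply/ler_addgt0Pr => e e0; have [v Dv wv] := (closure_normP _ _).1 cw e e0.
have := bdist_le z pD cw nw; have := ler_distD v z w; have := dD z v Dz Dv.
rewrite (distrC v); lra.
Qed.

Lemma ray_boundary D Delta z v : open D ->
  (forall x y, D x -> D y -> `|x - y| <= Delta) -> D z -> v != 0 ->
  exists2 t : R, 0 <= t & closure D (z + t *: v) /\ ~ D (z + t *: v).
Proof.
move=> oD dD Dz v0; have nv : 0 < `|v| by rewrite normr_gt0.
have D0 : 0 <= Delta by have := dD z z Dz Dz; rewrite subrr normr0.
pose r := (Delta + 1) / `|v|.
have [|t [/andP[t0 _] ct nt _]] := segment_boundary (v := r *: v) oD Dz.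
  move=> /(dD _ _ Dz); rewrite opprD addrA subrr add0r normrN normrZ.
  by rewrite ger0_norm ?divfK ?gt_eqF// ?divr_ge0//; lra.
exists (t * r); last by rewrite -scalerA.
by rewrite mulr_ge0// divr_ge0//; lra.
Qed.

(** The rays from z along u, - u and a transversal w end at three boundary points whose mutual
    distances are at least k. At most one of them is within less than k / 2 of q. *)
Lemma far_boundary_points D Delta z q (k : R) : dim_ge2 E -> proper_domain D ->
  (forall x y, D x -> D y -> `|x - y| <= Delta) -> D z -> 0 < k ->
  k <= bdist D z ->
  exists a b, [/\ closure D a /\ ~ D a, closure D b /\ ~ D b, k <= `|a - b|,
    k / 2 <= `|a - q| & k / 2 <= `|b - q|].
Proof.
move=> dimE pD dD Dz k0 kz; have oD : open D by case: pD => -[].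
have [u u0] := nonzero_vector dimE; have [w wu Hw] := riesz_line dimE u0.
have w0 : w != 0 by rewrite -normr_gt0 wu normr_gt0.
have far v t : 0 <= t -> closure D (z + t *: v) /\ ~ D (z + t *: v) -> k <= t * `|v|.
  move=> t0 [ct nt]; apply: (le_trans kz); have := bdist_le z pD ct nt.
  by rewrite opprD addrA subrr add0r normrN normrZ ger0_norm.
have [t1 t10 h1] := ray_boundary oD dD Dz u0.
have [|t2 t20 h2] := @ray_boundary _ _ _ (- u) oD dD Dz; first by rewrite oppr_eq0.
have [t3 t30 h3] := ray_boundary oD dD Dz w0.
have k1 := far _ _ t10 h1; have k2 := far _ _ t20 h2; have k3 := far _ _ t30 h3.
rewrite normrN in k2; rewrite wu in k3.
set b1 := z + t1 *: u in h1; set b2 := z + t2 *: - u in h2.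
set b3 := z + t3 *: w in h3.
have d12 : k <= `|b1 - b2|.
  rewrite opprD addrACA subrr add0r scalerN opprK -scalerDl normrZ ger0_norm ?addr_ge0//.
  by rewrite mulrDl; apply: (le_trans k1); rewrite lerDl mulr_ge0.
have d31 : k <= `|b3 - b1|.
  rewrite opprD addrACA subrr add0r -scaleNr.
  by apply: le_trans (Hw t3 (- t1)); rewrite ger0_norm.
have d32 : k <= `|b3 - b2|.
  rewrite opprD addrACA subrr add0r scalerN opprK.
  by apply: le_trans (Hw t3 t2); rewrite ger0_norm.
have [q1|q1] := ltP `|b1 - q| (k / 2).
  exists b3, b2; split => //.
    have := ler_distD q b3 b1; rewrite (distrC q); lra.
  have := ler_distD q b1 b2; rewrite (distrC q); lra.
have [q2|q2] := ltP `|b2 - q| (k / 2); last by exists b1, b2.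
exists b3, b1; split => //.
have := ler_distD q b3 b2; rewrite (distrC q); lra.
Qed.

Lemma uniform_domain_mono (c c' : R) D : c <= c' -> uniform_domain c D ->
  uniform_domain c' D.
Proof.
move=> cc [pD uD]; split => // x y Dx Dy.
have [a [b [g [arc lfin cone ll]]]] := uD x y Dx Dy.
exists a, b, g; split => // [t ht|].
  apply: le_trans (cone t ht) _; rewrite lee_fin ler_wpM2r// ltW// bdist_gt0//.
  by have [_ _ _ gD] := arc; apply: gD; exists t.
by apply: le_trans ll _; rewrite lee_fin ler_wpM2r.
Qed.

End boundary_points.

(** * Global estimates for pairs of domains with common bounds *)

Section core.
Context {R : realType}.
Context (c M Delta m L : R) (B : nat).
Context (c1 : 1 <= c).
Context (M1 : 1 <= M).
Context (Delta0 : 0 < Delta).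
Context (m0 : 0 < m).
Context (L1 : 1 <= L).
Context (MB : M <= (1 + (4 * (1 + 2 * c))^-1) ^+ B).
Context (B0 : (0 < B)%N).

Definition core_domain (E : normedModType R) (D : set E) : Prop :=
  [/\ uniform_domain c D, forall x y, D x -> D y -> `|x - y| <= Delta
    & exists x y, [/\ D x, D y & m <= `|x - y|]].

Definition quarter_step (E F : normedModType R) (D : set E) (D' : set F) f : Prop :=
  forall x y, D x -> D y -> `|x - y| <= bdist D x / 4 ->
    close (bdist D') M (f x) (f y).

(** The two halves of a uniform arc from u to v, moved by g, meet at the image of the cut point.
    This is the affine control of the j-distance in exponential form. *)
Lemma close_uniform (E F : normedModType R) (D : set E) (D' : set F) g u v :
  uniform_domain c D' -> proper_domain D -> (forall u, D' u -> D (g u)) ->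
  quarter_step D' D g -> D' u -> D' v ->
  close (bdist D) (M * M * ((1 + c * `|u - v| / bdist D' u) *
    (1 + c * `|u - v| / bdist D' v)) ^+ B) (g u) (g v).
Proof. have [[hc hM] hm] := (c1, M1, m0).
move=> uD' pD gD step D'u D'v; have pD' := uD'.1; have c0 : 0 <= c by lra.
have [a1 [T1 [g1 [s1 [a2 [T2 [g2 [s2 [h1 h2 [e1 e2 e3] [l1 l2] _]]]]]]]]] :=
  uniform_halves uD' D'u D'v.
have lD := lip1_bdist pD.
have dge0 x : D' x -> 0 <= bdist D (g x).
  by move=> D'x; rewrite ltW// bdist_gt0//; exact: gD.
have k1 := close_half_arc c0 M1 MB lD dge0 pD' step h1.
have k2 := close_half_arc c0 M1 MB lD dge0 pD' step h2.
rewrite e1 in k1; rewrite e2 -e3 in k2.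
have s1ge : 0 <= s1 T1.
  case: h1 => [aT _ sa hs _]; have := hs a1 T1 (lexx _) aT (lexx _).
  by rewrite sa subr0; apply: le_trans.
have s2ge : 0 <= s2 T2.
  case: h2 => [aT _ sa hs _]; have := hs a2 T2 (lexx _) aT (lexx _).
  by rewrite sa subr0; apply: le_trans.
have du := bdist_gt0 pD' D'u; have dv := bdist_gt0 pD' D'v.
have D'T : D' (g1 T1).
  by case: h1 => [aT _ _ _ hD]; have [] := hD T1; rewrite ?aT ?lexx.
have pge1 (s d : R) : 0 <= s -> 0 < d -> 1 <= M * (1 + s / d) ^+ B.
  by move=> s0 d0; rewrite mulr_ege1// exprn_ege1// lerDl divr_ge0// ltW.
have := close_trans lD (pge1 _ _ s1ge du) (pge1 _ _ s2ge dv) k1 (close_sym k2).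
apply: close_mono; [exact: dge0|exact: dge0|].
rewrite mulrACA -exprMn ler_pM2l; last by rewrite mulr_gt0//; lra.
have le1 (s l d : R) : 0 <= s -> s <= l -> 0 < d -> 0 <= 1 + s / d <= 1 + l / d.
  move=> s0 sl d0; rewrite addr_ge0 ?divr_ge0 ?(ltW d0)//=.
  by rewrite lerD2l ler_pM2r ?invr_gt0.
have /andP[p1 q1] := le1 _ _ _ s1ge l1 du; have /andP[p2 q2] := le1 _ _ _ s2ge l2 dv.
apply: lerXn2r; rewrite ?nnegrE; [by rewrite mulr_ge0| |exact: ler_pM].
by apply: mulr_ge0; [exact: le_trans q1|exact: le_trans q2].
Qed.

(** The constant of the geometric summation over half of an arc. *)
Definition gain (alpha : R) : R :=
  1 + ((1 + (4 * (1 + 2 * c))^-1) `^ alpha - 1)^-1.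

Lemma gain_ge1 alpha : 0 < alpha -> 1 <= gain alpha.
Proof. have [[hc hM] hm] := (c1, M1, m0).
move=> al0; rewrite /gain lerDl invr_ge0 subr_ge0.
have al1 : 1 `^ alpha = 1 :> R by rewrite powR1.
rewrite -[leLHS]al1; apply: ge0_ler_powR; rewrite ?nnegrE ?ltW//.
  by rewrite addr_gt0// invr_gt0; lra.
by rewrite ltrDl invr_gt0; lra.
Qed.

(** The height bound is required only where the distance to one of the ends is at most c times the
    distance to the boundary, as it is along the arc. This restriction later keeps the arc away from
    a given point near the boundary. *)
Lemma sum_uniform (E F : normedModType R) (D : set E) (D' : set F) f (A alpha : R) x y :
  uniform_domain c D -> proper_domain D' -> (forall x, D x -> D' (f x)) ->
  quarter_step D D' f -> 0 <= A -> 0 < alpha -> D x -> D y ->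
  (forall z, D z -> Num.min `|z - x| `|z - y| <= c * bdist D z ->
    bdist D' (f z) <= A * bdist D z `^ alpha) ->
  `|f x - f y| <= M * A * gain alpha * ((bdist D x + c * `|x - y|) `^ alpha +
     (bdist D y + c * `|x - y|) `^ alpha).
Proof. have [[hc hM] hm] := (c1, M1, m0).
move=> uD pD' fD step A0 al0 Dx Dy hA; have pD := uD.1; have c0 : 0 <= c by lra.
have [a1 [T1 [g1 [s1 [a2 [T2 [g2 [s2 [h1 h2 [e1 e2 e3] [l1 l2] cone]]]]]]]]] :=
  uniform_halves uD Dx Dy.
have step' u v : D u -> D v -> `|u - v| <= bdist D u / 4 ->
    `|f u - f v| <= M * bdist D' (f u).
  move=> Du Dv uv; have [h _] := step u v Du Dv uv; apply: (le_trans h).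
  by rewrite ler_wpM2r; [|rewrite ltW// bdist_gt0//; exact: fD|lra].
have M0 : 0 <= M by lra.
have k1 := @sum_half_arc _ _ _ f (fun u => bdist D' (f u)) M A alpha c D a1 T1 g1 s1
  c0 M0 A0 al0 pD step' h1.
have k2 := @sum_half_arc _ _ _ f (fun u => bdist D' (f u)) M A alpha c D a2 T2 g2 s2
  c0 M0 A0 al0 pD step' h2.
have {}k1 : `|f x - f (g1 T1)| <=
    M * A * gain alpha * (bdist D x + s1 T1) `^ alpha.
  rewrite -e1; apply: k1 => t ht; apply: hA.
    by case: h1 => [_ _ _ _ /(_ t ht)[]].
  by apply: cone; left; exists t.
have {}k2 : `|f y - f (g1 T1)| <=
    M * A * gain alpha * (bdist D y + s2 T2) `^ alpha.
  rewrite -e2 e3; apply: k2 => t ht; apply: hA.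
    by case: h2 => [_ _ _ _ /(_ t ht)[]].
  by apply: cone; right; exists t.
have K0 : 0 <= M * A * gain alpha.
  by rewrite !mulr_ge0// (le_trans ler01)// gain_ge1.
have mono (p q : R) : 0 <= p -> p <= q -> p `^ alpha <= q `^ alpha.
  move=> p0 pq; apply: ge0_ler_powR; rewrite ?nnegrE ?(ltW al0)//.
  exact: le_trans pq.
have dx := bdist_gt0 pD Dx; have dy := bdist_gt0 pD Dy.
have s1ge : 0 <= s1 T1.
  case: h1 => [aT _ sa hs _]; have := hs a1 T1 (lexx _) aT (lexx _).
  by rewrite sa subr0; apply: le_trans.
have s2ge : 0 <= s2 T2.
  case: h2 => [aT _ sa hs _]; have := hs a2 T2 (lexx _) aT (lexx _).
  by rewrite sa subr0; apply: le_trans.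
apply: le_trans (ler_distD (f (g1 T1)) _ _) _; rewrite mulrDr; apply: lerD.
  apply: (le_trans k1); rewrite ler_wpM2l// mono ?lerD2l// addr_ge0//.
  exact: ltW.
rewrite distrC; apply: (le_trans k2); rewrite ler_wpM2l// mono ?lerD2l// addr_ge0//.
exact: ltW.
Qed.

Definition core_radius : R := m / (2 * c).

Lemma core_radius_gt0 : 0 < core_radius.
Proof. have [[hc hM] hm] := (c1, M1, m0); by rewrite divr_gt0//; lra. Qed.

Lemma core_center (E : normedModType R) (D : set E) : core_domain D ->
  exists2 z, D z & core_radius <= bdist D z.
Proof. have [[hc hM] hm] := (c1, M1, m0).
move=> [uD _ [x [y [Dx Dy xy]]]]; have [z Dz hz] := uniform_center uD Dx Dy.
exists z => //; rewrite /core_radius ler_pdivrMr; last lra.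
by apply: (le_trans xy); rewrite mulrC.
Qed.

(** A bound for the constant of [close_uniform] between a point and a centre, after multiplication
    by the power [B] of the height of the point, which clears its denominator. *)
Definition coreC1 : R :=
  M * M * ((1 + c) * Delta * (1 + c * Delta / core_radius)) ^+ B.

Lemma coreC1_ge0 : 0 <= coreC1.
Proof. have [[hc hM] hm] := (c1, M1, m0).
have k0 := core_radius_gt0.
rewrite !mulr_ge0 ?exprn_ge0//; [lra|lra|].
rewrite !mulr_ge0 ?addr_ge0 ?divr_ge0 ?mulr_ge0 ?(ltW Delta0) ?(ltW k0)//; lra.
Qed.

(* The image of [x] is joined to the centre [z'] along a uniform arc of [D'],
   which is moved back to [D] by [g]. *)
Lemma core_height (E F : normedModType R) (D : set E) (D' : set F) f g x z' :
  core_domain D' -> proper_domain D -> mutually_inverse D D' f g ->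
  quarter_step D' D g -> D x -> D' z' -> core_radius <= bdist D' z' ->
  let h := bdist D' (f x) ^+ B in
  [/\ h * `|x - g z'| <= coreC1 * bdist D x,
     h * `|x - g z'| <= coreC1 * bdist D (g z')
   & h * bdist D (g z') <= coreC1 * bdist D x].
Proof. have [[hc hM] hm] := (c1, M1, m0).
move=> [uD' diam' _] pD [fg gf] step Dx D'z zr h.
have [D'x gfx] := fg x Dx; have pD' := uD'.1; have k0 := core_radius_gt0.
have := close_uniform uD' pD (fun u Du => (gf u Du).1) step D'x D'z.
rewrite gfx; set K := M * M * _ => cl.
have Dq : D (g z') by exact: (gf z' D'z).1.
have dx := bdist_gt0 pD Dx; have dq := bdist_gt0 pD Dq.
have h0 : 0 < bdist D' (f x) by exact: bdist_gt0.
have hK : h * K <= coreC1.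
  have -> : h * K = M * M * (bdist D' (f x) * ((1 + c * `|f x - z'| / bdist D' (f x)) *
       (1 + c * `|f x - z'| / bdist D' z'))) ^+ B.
    by rewrite /h /K [in RHS]exprMn mulrCA.
  rewrite /coreC1 ler_pM2l; last by rewrite mulr_gt0//; lra.
  have dz : 0 < bdist D' z' by exact: bdist_gt0.
  have hd := bdist_le_diam pD' diam' D'x; have hr := diam' _ _ D'x D'z.
  have r0 := normr_ge0 (f x - z').
  have e1 : bdist D' (f x) * (1 + c * `|f x - z'| / bdist D' (f x)) =
      bdist D' (f x) + c * `|f x - z'|.
    by field; rewrite gt_eqF.
  have p0 : 0 <= bdist D' (f x) + c * `|f x - z'|.
    by rewrite addr_ge0 ?(ltW h0)// mulr_ge0//; lra.
  have p1 : 0 <= 1 + c * `|f x - z'| / bdist D' z'.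
    by rewrite addr_ge0// divr_ge0 ?(ltW dz)// mulr_ge0//; lra.
  rewrite mulrA e1; apply: lerXn2r; rewrite ?nnegrE.
  - by rewrite mulr_ge0.
  - by rewrite !mulr_ge0 ?addr_ge0 ?divr_ge0 ?mulr_ge0 ?(ltW Delta0) ?(ltW k0)//; lra.
  apply: ler_pM => //; first by nra.
  rewrite lerD2l; apply: ler_pM => //.
  - by rewrite mulr_ge0//; lra.
  - by rewrite invr_ge0 ltW.
  - by rewrite ler_wpM2l//; lra.
  - by rewrite lef_pV2 ?posrE.
have hge0 : 0 <= h by rewrite exprn_ge0// ltW.
have [c1' c2'] := cl; have c3 := close_dist (lip1_bdist pD) cl.
have fin (a b : R) : a <= K * b -> 0 < b -> h * a <= coreC1 * b.
  move=> ab b0; apply: (@le_trans _ _ (h * (K * b))); first by rewrite ler_wpM2l.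
  by rewrite mulrA ler_wpM2r// ltW.
split; apply: fin => //.
  by apply: (le_trans c1'); rewrite ler_wpM2r ?(ltW dx)//; lra.
by apply: (le_trans c2'); rewrite ler_wpM2r ?(ltW dq)//; lra.
Qed.

Lemma le_root (x y : R) n : 0 <= x -> (0 < n)%N -> x ^+ n <= y ->
  x <= y `^ n%:R^-1.
Proof.
move=> x0 n0 xy; have -> : x = (x ^+ n) `^ n%:R^-1.
  by rewrite -powR_mulrn// -powRrM divff ?powRr1// pnatr_eq0 -lt0n.
by apply: ge0_ler_powR; rewrite ?nnegrE ?invr_ge0 ?exprn_ge0// (le_trans _ xy)// exprn_ge0.
Qed.

Lemma root_pow (x : R) n : 0 <= x -> (0 < n)%N -> (x `^ n%:R^-1) ^+ n = x.
Proof.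
move=> x0 n0; rewrite -powR_mulrn ?powR_ge0// -powRrM mulVf ?powRr1//.
by rewrite pnatr_eq0 -lt0n.
Qed.

(* What remains of the boundary condition: pairs of boundary points are
   approached by pairs of points that [f] does not contract too much. *)
Definition boundary_lower (E F : normedModType R) (D : set E) (f : E -> F) : Prop :=
  forall a b, closure D a /\ ~ D a -> closure D b /\ ~ D b ->
  forall e, 0 < e -> exists a' b', [/\ D a', D b', `|a - a'| < e, `|b - b'| < e
    & `|a - b| / L - e <= `|f a' - f b'|].

(* If the preimage of the centre of [D'] were close to the boundary, [f] would
   map the part of [D] far from it, hence two boundary points that are far
   apart, to a small set. *)
Lemma core_preimage_center : exists2 k, 0 < k &
  forall (E F : normedModType R) (D : set E) (D' : set F) f g z', dim_ge2 E ->
  core_domain D -> core_domain D' -> mutually_inverse D D' f g ->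
  quarter_step D D' f -> quarter_step D' D g -> boundary_lower D f ->
  D' z' -> core_radius <= bdist D' z' -> k <= bdist D (g z').
Proof.
have [[hc hM] hm] := (c1, M1, m0); have [hL hDelta] := (L1, Delta0).
have M0 : 0 <= M by lra.
have c0 : 0 <= c by lra.
have c10 : 0 <= 1 + c by lra.
have L0 : 0 < L by lra.
have L2 : 0 <= 2 * L by lra.
have Dge0 := ltW hDelta.
set kap := core_radius; have kap0 : 0 < kap := core_radius_gt0.
have e0 : 0 < kap / (4 * L) by rewrite divr_gt0//; lra.
have eL : kap / (4 * L) <= kap / 4.
  by rewrite ler_pM2l// lef_pV2 ?posrE; lra.
have e1 : kap / L = 4 * (kap / (4 * L)) by field; rewrite gt_eqF.
have e2 : kap / (2 * L) = 2 * (kap / (4 * L)) by field; rewrite gt_eqF.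
(* Twice [B], because two height estimates are multiplied, one containing d(z) and the other
   d(q). *)
pose n := (B + B)%N; have n0 : (0 < n)%N by rewrite addn_gt0 B0.
pose al : R := n%:R^-1; have al0 : 0 < al by rewrite invr_gt0 ltr0n.
(* If d(q) < k1, a point z of the arc within k1 of q would have height at most 2 k1, hence lie
   within kap / 8 of [a'] or [b']; but these are at distance at least kap / 4 from q. *)
pose k1 := kap / (16 * c); have k10 : 0 < k1 by rewrite divr_gt0//; lra.
have ck1 : c * (2 * k1) = kap / 8 by rewrite /k1; field; rewrite gt_eqF//; lra.
have k1kap : k1 <= kap / 16.
  by rewrite ler_pdivrMr; [nra|lra].
pose W := coreC1 ^+ 2 / k1 ^+ 2.
have W0 : 0 <= W by rewrite divr_ge0 ?exprn_ge0 ?coreC1_ge0 ?(ltW k10).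
pose P := ((1 + c) * Delta) `^ al.
have P0 : 0 <= P by exact: powR_ge0.
pose C3 := M * W `^ al * gain al * (P + P) + 1.
have G0 : 0 <= gain al by apply: le_trans (gain_ge1 al0).
have C30 : 0 < C3.
  by rewrite ltr_wpDl// !mulr_ge0 ?powR_ge0//; lra.
(* The second entry solves kap / (2 L) <= C3 d(q)^(1 / n), which compares the lower and the upper
   bound for |f a' - f b'|. *)
exists (Num.min k1 ((kap / (2 * L) / C3) ^+ n)).
  by rewrite lt_min k10 exprn_gt0// !divr_gt0//; lra.
move=> E F D D' f g z' dimE cD cD' fg step step' bl D'z hz.
rewrite ge_min; have [//|qk] := leP k1 (bdist D (g z')).
set q := g z' in qk *; set dq := bdist D q in qk *.
have [uD diamD [x0 [y0 [Dx0 _ _]]]] := cD; have pD := uD.1.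
have pD' : proper_domain D' by case: cD' => -[].
have Dq : D q by exact: (fg.2 z' D'z).1.
have dq0 : 0 < dq by exact: bdist_gt0.
have [zc Dzc hzc] := core_center cD.
have [a [b [ba bb ab aq bq]]] := far_boundary_points q dimE pD diamD Dzc kap0 hzc.
have [a' [b' [Da' Db' aa' bb' fab]]] := bl a b ba bb _ e0.
have a'q : kap / 4 <= `|a' - q|.
  have := ler_distD a' a q; lra.
have b'q : kap / 4 <= `|b' - q|.
  have := ler_distD b' b q; lra.
have height z : D z -> Num.min `|z - a'| `|z - b'| <= c * bdist D z ->
    bdist D' (f z) <= (W * dq) `^ al * bdist D z `^ al.
  move=> Dz cone; have dz0 := bdist_gt0 pD Dz.
  have zq : k1 <= `|z - q|.
    rewrite leNgt; apply/negP => zq.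
    have dz : bdist D z <= 2 * k1 by have := bdist_lip z q pD; rewrite -/dq; lra.
    have : c * bdist D z <= kap / 8 by rewrite -ck1 ler_wpM2l.
    move: cone; rewrite ge_min => /orP[] h1 h2.
      have := ler_distD z a' q; rewrite (distrC a' z); lra.
    have := ler_distD z b' q; rewrite (distrC b' z); lra.
  have [h1 h2 _] := core_height cD' pD fg step' Dz D'z hz.
  have h0 : 0 <= bdist D' (f z) by rewrite ltW// bdist_gt0//; exact: (fg.1 z Dz).1.
  have Wq : 0 <= W * dq by rewrite mulr_ge0// ltW.
  rewrite -powRM//; last exact: ltW.
  apply: (@le_root _ _ n) => //.
  set h := bdist D' (f z) ^+ B in h1 h2.
  have hB : 0 <= h by rewrite exprn_ge0.
  have hk z1 : h * `|z - q| <= coreC1 * z1 -> h * k1 <= coreC1 * z1.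
    by apply: le_trans; rewrite ler_wpM2l.
  have hh : h ^+ 2 * k1 ^+ 2 <= coreC1 ^+ 2 * (dq * bdist D z).
    rewrite -exprMn (_ : _ * (_ * _) = (coreC1 * bdist D z) * (coreC1 * dq)); last by ring.
    have hk0 : 0 <= h * k1 by rewrite mulr_ge0// ltW.
    by rewrite expr2; apply: ler_pM => //; exact: hk.
  rewrite exprD -/h -expr2 /W.
  rewrite (_ : _ / _ * _ * _ = coreC1 ^+ 2 * (dq * bdist D z) / k1 ^+ 2); last by ring.
  by rewrite ler_pdivlMr// exprn_gt0.
have A0 : 0 <= (W * dq) `^ al by exact: powR_ge0.
have fD x : D x -> D' (f x) by move=> Dx; exact: (fg.1 x Dx).1.
have sum := sum_uniform uD pD' fD step A0 al0 Da' Db' height.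
have Pb z : D z -> (bdist D z + c * `|a' - b'|) `^ al <= P.
  move=> Dz; have h1 := bdist_le_diam pD diamD Dz; have h2 := diamD _ _ Da' Db'.
  have h3 := bdist_gt0 pD Dz; have h4 := normr_ge0 (a' - b').
  apply: ge0_ler_powR; rewrite ?nnegrE ?(ltW al0)//.
  - by rewrite addr_ge0 ?(ltW h3)// mulr_ge0//; lra.
  - by rewrite mulr_ge0//; lra.
  - by nra.
have low : kap / (2 * L) <= `|f a' - f b'|.
  apply: le_trans fab; have h1 : kap / L <= `|a - b| / L.
    by rewrite ler_pM2r// invr_gt0.
  lra.
have up : `|f a' - f b'| <= C3 * dq `^ al.
  apply: (le_trans sum); rewrite powRM// ?(ltW dq0)//.
  apply: (@le_trans _ _ (M * (W `^ al * dq `^ al) * gain al * (P + P))).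
    rewrite ler_wpM2l//; last by apply: lerD; exact: Pb.
    by rewrite !mulr_ge0 ?powR_ge0//; lra.
  rewrite /C3 mulrDl mul1r.
  rewrite (_ : M * (W `^ al * dq `^ al) * gain al * (P + P) =
    M * W `^ al * gain al * (P + P) * dq `^ al); last by ring.
  by rewrite lerDl powR_ge0.
rewrite -(root_pow (ltW dq0) n0) -/al; apply: lerXn2r; rewrite ?nnegrE ?powR_ge0//.
  by rewrite !divr_ge0 ?(ltW kap0) ?(ltW C30)//; lra.
by rewrite ler_pdivrMr// [leRHS]mulrC; exact: le_trans up.
Qed.

Lemma core_holder (tau C0 : R) (N : nat) : 0 < tau -> tau <= 1 -> (0 < N)%N -> (N <= B)%N ->
  exists2 C, 1 <= C &
  forall (E F : normedModType R) (D : set E) (D' : set F) f g, dim_ge2 E ->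
  core_domain D -> core_domain D' -> mutually_inverse D D' f g ->
  quarter_step D D' f -> quarter_step D' D g -> boundary_lower D f ->
  (forall x y, D x -> `|y - x| <= tau * bdist D x ->
    `|f y - f x| ^+ N * bdist D x <= C0 * `|y - x| * bdist D' (f x) ^+ N) ->
  forall x y, D x -> D y -> `|f x - f y| <= C * `|x - y| `^ B%:R^-1.
Proof.
move=> tau0 tau1 N0 NB; have [[hc hM] hm] := (c1, M1, m0).
have M0 : 0 <= M by lra.
have c0 : 0 <= c by lra.
have [k k0 Hk] := core_preimage_center.
pose al : R := B%:R^-1; have al0 : 0 < al by rewrite invr_gt0 ltr0n.
pose A := (coreC1 / k) `^ al; have A0 : 0 <= A by exact: powR_ge0.
have G0 : 0 <= gain al by apply: le_trans (gain_ge1 al0).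
pose C5 := M * A * gain al * (2 * (1 / tau + 1 + c) `^ al).
(* With K at least 1, [C0] is at most K^N. *)
pose K := Num.max 1 C0; have K1 : 1 <= K by rewrite le_max lexx.
have Kgt0 : 0 < K by lra.
have K0 := ltW Kgt0.
have C50 : 0 <= C5.
  by rewrite !mulr_ge0 ?powR_ge0//; lra.
have KA0 : 0 <= K * A by rewrite mulr_ge0//; lra.
exists (1 + C5 + K * A); first by lra.
move=> E F D D' f g dimE cD cD' fg step step' bl loc x y Dx Dy.
have [uD diamD _] := cD; have pD := uD.1.
have pD' : proper_domain D' by case: cD' => -[].
have fD z : D z -> D' (f z) by move=> Dz; exact: (fg.1 z Dz).1.
have [z' D'z hz'] := core_center cD'.
have qk := Hk E F D D' f g z' dimE cD cD' fg step step' bl D'z hz'.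
have height z : D z -> bdist D' (f z) <= A * bdist D z `^ al.
  move=> Dz; have dz0 := bdist_gt0 pD Dz; have hz0 := bdist_gt0 pD' (fD z Dz).
  have [_ _ h] := core_height cD' pD fg step' Dz D'z hz'.
  rewrite -powRM ?divr_ge0 ?coreC1_ge0 ?(ltW k0) ?(ltW dz0)//.
  apply: (@le_root _ _ B) => //; first exact: ltW.
  rewrite mulrAC ler_pdivlMr//; apply: le_trans h; rewrite ler_wpM2l// exprn_ge0//.
  exact: ltW.
have dx0 := bdist_gt0 pD Dx; have dy0 := bdist_gt0 pD Dy.
have r0 := normr_ge0 (x - y).
have pr0 : 0 <= `|x - y| `^ al by exact: powR_ge0.
(* For far pairs the distances of x and y to the boundary are bounded by multiples of |x - y|, so
   the sum along a uniform arc already has the right order. *)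
have [near|far] := leP `|y - x| (tau * bdist D x); last first.
  have bound : `|f x - f y| <= C5 * `|x - y| `^ al.
    apply: le_trans (sum_uniform uD pD' fD step A0 al0 Dx Dy (fun z Dz _ => height z Dz)) _.
    rewrite /C5 -!mulrA; do 3 (rewrite ler_wpM2l//; try lra).
    have t1 : 0 <= 1 / tau + 1 + c by rewrite !addr_ge0 ?divr_ge0 ?(ltW tau0)//; lra.
    have b z : 0 <= bdist D z -> bdist D z <= (1 / tau + 1) * `|x - y| ->
        (bdist D z + c * `|x - y|) `^ al <= (1 / tau + 1 + c) `^ al * `|x - y| `^ al.
      move=> z0 hz; rewrite -powRM//; apply: ge0_ler_powR; rewrite ?nnegrE ?(ltW al0)//.
      - by rewrite addr_ge0// mulr_ge0//; lra.
      - by rewrite mulr_ge0.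
      - by rewrite mulrDl lerD2r.
    have hx : bdist D x <= 1 / tau * `|x - y|.
      by rewrite mulrAC mul1r ler_pdivlMr// mulrC distrC ltW.
    have hy : bdist D y <= (1 / tau + 1) * `|x - y|.
      by have := bdist_lip y x pD; rewrite (distrC y) mulrDl mul1r; lra.
    have hx' : bdist D x <= (1 / tau + 1) * `|x - y| by rewrite mulrDl mul1r; lra.
    by rewrite mulr_natl mulr2n; apply: lerD; apply: b => //; exact: ltW.
  apply: (le_trans bound); rewrite ler_wpM2r//; lra.
have bound : `|f x - f y| <= K * A * `|x - y| `^ al.
  have h0 := bdist_gt0 pD' (fD x Dx); have hA := height x Dx.
  set h := bdist D' (f x) in h0 hA.
  have := loc x y Dx near; rewrite distrC (distrC y) -/h => hN.
  (* As [xi] and [r] are at most 1 and N <= B, the exponent 1 / N may be lowered to 1 / B. It then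
     matches the power of d(x) in the bound for [h], and d(x) cancels. *)
  pose xi := `|f x - f y| / (K * h).
  have Kh0 : 0 < K * h by rewrite mulr_gt0//; lra.
  have xi0 : 0 <= xi by rewrite divr_ge0// ltW.
  pose r := `|x - y| / bdist D x.
  have rr0 : 0 <= r by rewrite divr_ge0// ltW.
  have r1 : r <= 1.
    rewrite ler_pdivrMr// mul1r distrC; apply: (le_trans near).
    by rewrite ler_piMl// ltW.
  have xiN : xi ^+ N <= r.
    rewrite /xi expr_div_n exprMn ler_pdivrMr; last by rewrite mulr_gt0// exprn_gt0//; lra.
    rewrite /r mulrAC ler_pdivlMr//; apply: (le_trans hN).
    rewrite (mulrC C0) -mulrA ler_wpM2l// ler_wpM2r ?exprn_ge0 ?(ltW h0)//.
    have : K <= K ^+ N by rewrite -[leLHS]expr1 ler_weXn2l.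
    by apply: le_trans; rewrite le_max lexx orbT.
  have xi1 : xi <= 1.
    by rewrite -(@expr_le1 _ N)//; exact: le_trans r1.
  have xiB : xi ^+ B <= r by apply: le_trans xiN; exact: ler_wiXn2l.
  have xir := le_root xi0 B0 xiB; rewrite -/al in xir.
  have -> : `|f x - f y| = K * h * xi by rewrite /xi mulrC divfK// gt_eqF.
  have rE : bdist D x `^ al * r `^ al = `|x - y| `^ al.
    by rewrite -powRM ?(ltW dx0)// /r mulrC divfK// gt_eqF.
  rewrite -!mulrA ler_wpM2l//.
  rewrite -rE [leRHS]mulrA; apply: ler_pM => //; exact: ltW.
apply: (le_trans bound); rewrite ler_wpM2r//; lra.
Qed.

End core.

(** * The boundary condition *)

Section extended_maps.
Context {R : realType}.
Implicit Types (E F : normedModType R).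

Lemma norm_bounded E (D : set E) : bounded_set D <->
  exists2 M : R, 0 < M & forall x, D x -> `|x| <= M.
Proof.
split=> [[M [_ HM]]|[M M0 HM]].
  exists (Num.max 1 (M + 1)); first by rewrite lt_max ltr01.
  by apply: HM; rewrite lt_max ltrDl ltr01 orbT.
exists M; split=> [|r Mr x Dx]; first exact: num_real.
exact: le_trans (HM x Dx) (ltW Mr).
Qed.

Lemma infty_closure E (D : set E) :
  ~ closure (fin @` D) (infty : ext_space E) <-> bounded_set D.
Proof.
split=> [|/norm_bounded[M M0 HM] cl].
  move=> /existsNP[U /not_implyP[[B [cB bB] BU] /set0P/negP]]; rewrite negbK => /eqP U0.
  have [M M0 HM] := (norm_bounded B).1 bB; apply/norm_bounded; exists M => // x Dx.
  apply: HM; apply: contrapT => nBx; suff : set0 (fin x : ext_space E) by [].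
  by rewrite -U0; split; [exists x|apply: BU; left; exists x].
have [|p [[x Dx <-]]] := cl (fin @` (~` closed_ball (0 : E) M) `|` [set infty]).
  exists (closed_ball (0 : E) M) => //; split; first exact: closed_ball_closed.
  apply/norm_bounded; exists M => // x.
  by rewrite closed_ballE// /closed_ball_ /= sub0r normrN.
move=> [[y ny [yx]]|//]; apply: ny.
by rewrite closed_ballE// /closed_ball_ /= sub0r normrN yx HM.
Qed.

Lemma ext_continuous_near E F (D : set E) (A : set (ext_space E))
    (f : ext_space E -> ext_space F) (h : E -> F) a b :
  {within A, continuous f} -> A (fin a) -> f (fin a) = fin b ->
  (forall x, D x -> A (fin x) /\ f (fin x) = fin (h x)) ->
  forall e : R, 0 < e -> exists2 d : R, 0 < d & forall x, D x -> `|a - x| < d ->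
    `|b - h x| < e.
Proof.
move=> /subspace_continuousP cf Aa fa fh e e0.
have nb : nbhs (f (fin a)) (fin @` ball b e).
  rewrite fa; apply: (@filterS _ (nbhs b) _ (ball b e)) => [y|]; first by exists y.
  exact: nbhsx_ballx.
have := cf _ Aa _ nb; rewrite /= /within /= => /nbhs_ballP[d /= d0 Hd].
exists d => // x Dx ax; have [Ax fx] := fh x Dx.
have : (fin @` ball b e) (f (fin x)) by apply: (Hd x) => //; rewrite -ball_normE.
by rewrite fx => -[y]; rewrite -ball_normE /= => + [<-].
Qed.

Lemma near_boundary_lower E F (D : set E) (h : E -> F) (bv : E -> F) (L : R) :
  (forall a, closure D a /\ ~ D a -> forall e : R, 0 < e ->
    exists2 d : R, 0 < d & forall x, D x -> `|a - x| < d -> `|bv a - h x| < e) ->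
  (forall a b, closure D a /\ ~ D a -> closure D b /\ ~ D b ->
    `|a - b| / L <= `|bv a - bv b|) ->
  boundary_lower L D h.
Proof.
move=> near lower a b ba bb e e0; have e2 : 0 < e / 2 by rewrite divr_gt0.
have close_point p : closure D p /\ ~ D p ->
    exists p', [/\ D p', `|p - p'| < e & `|bv p - h p'| < e / 2].
  move=> bp; have [d d0 Hd] := near p bp _ e2.
  have [|p' Dp'] := (closure_normP D p).1 bp.1 (Num.min d e); first by rewrite lt_min d0.
  by rewrite lt_min => /andP[pd pe]; exists p'; split => //; exact: Hd.
have [a' [Da' aa' ha]] := close_point a ba.
have [b' [Db' bb' hb]] := close_point b bb.
exists a', b'; split => //.
have := lower a b ba bb; have := ler_distD (h a') (bv a) (bv b).
have := ler_distD (h b') (h a') (bv b); rewrite (distrC (h b')); lra.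
Qed.

End extended_maps.

Lemma FQ_steps_quarter (R : realType) (phi : R -> R) (M : R)
    (E F : normedModType R) (D : set E) (D' : set F) f g : 1 <= M ->
  (forall s, 0 <= s <= 1 -> phi s <= ln M) ->
  mutually_inverse D D' f g -> domain D -> FQ_steps phi D f g ->
  quarter_step M D D' f /\ quarter_step M D' D g.
Proof.
move=> M1 HM fg dD FQ; have [_ _] := FQ D dD (@subset_refl _ D).
have -> : f @` D = D'.
  rewrite eqEsubset; split=> [_ [x Dx <-]|u D'u]; first exact: (fg.1 x Dx).1.
  by exists (g u); [exact: (fg.2 u D'u).1|exact: (fg.2 u D'u).2].
have quarter : 0 <= 1 / 4 :> R /\ 1 / 4 <= 1 / 4 :> R by split; lra.
have hs s : 0 <= s <= 3 * (1 / 4) -> phi s <= ln M.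
  by move=> /andP[s0 s1]; apply: HM; apply/andP; split; lra.
move=> st st'; split=> x y Dx Dy xy; [apply: (st (1 / 4))|apply: (st' (1 / 4))] => //.
- by apply/andP; exact: quarter.
- by apply: (le_trans xy); lra.
- by apply/andP; exact: quarter.
- by apply: (le_trans xy); lra.
Qed.

(** * Common bounds from the boundary condition *)

Section main.
Context {R : realType} {E F : normedModType R}.
Context (c L delta : R) (D : set E) (D' : set F).
Context (f : ext_space E -> ext_space F).
Context (dimE : dim_ge2 E).
Context (uD : uniform_domain c D).
Context (uD' : uniform_domain c D').
Context (hf : homeo (closure (fin @` D)) (closure (fin @` D')) f).
Context (fDE : f @` (fin @` D) = fin @` D').
Context (bf : boundary_bilipschitz L D D' f).
Context (bD : bounded_set D).
Context (diamD : diam D = delta).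
Context (L1 : 1 <= L).

Local Notation h := (fin_part f).

Let oD : open D. Proof. by case: uD => -[[]]. Qed.
Let oD' : open D'. Proof. by case: uD' => -[[]]. Qed.

Lemma fin_partE x : D x -> f (fin x) = fin (h x).
Proof.
move=> Dx; have : (f @` (fin @` D)) (f (fin x)) by exists (fin x) => //; exists x.
by rewrite fDE /fin_part => -[u _ <-].
Qed.

Lemma boundary_value a : closure D a /\ ~ D a ->
  f (fin a) = fin (h a) /\ (closure D' (h a) /\ ~ D' (h a)).
Proof.
move=> ba; have : (f @` (ext_boundary D `&` range fin)) (f (fin a)).
  by exists (fin a) => //; split; [exact/ext_boundary_fin|exists a].
rewrite bf.1 => -[bfa [u _ fu]]; rewrite -fu in bfa.
have -> : h a = u by rewrite /fin_part -fu.
by split=> //; exact/ext_boundary_fin.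
Qed.

Lemma boundary_surj p : closure D' p /\ ~ D' p ->
  exists2 a, closure D a /\ ~ D a & f (fin a) = fin p.
Proof.
move=> bp; have : (ext_boundary D' `&` range fin) (fin p).
  by split; [exact/ext_boundary_fin|exists p].
rewrite -bf.1 => -[x [bx [a _ ax]] fa]; rewrite -ax in bx fa.
by exists a => //; exact/ext_boundary_fin.
Qed.

Lemma boundary_lipschitz a b : closure D a /\ ~ D a -> closure D b /\ ~ D b ->
  `|a - b| / L <= `|h a - h b| /\ `|h a - h b| <= L * `|a - b|.
Proof. by move=> ba bb; apply: bf.2; exact/ext_boundary_fin. Qed.

Lemma dist_le_diam x y : D x -> D y -> `|x - y| <= delta.
Proof.
move=> Dx Dy; rewrite -diamD; have [M M0 HM] := (norm_bounded D).1 bD.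
apply: ub_le_sup; last by exists x => //; exists y.
exists (M + M) => _ [a Da [b Db <-]]; apply: le_trans (ler_normB _ _) _.
by apply: lerD; exact: HM.
Qed.

Lemma boundary_dist_le_diam a b : closure D a -> closure D b -> `|a - b| <= delta.
Proof.
move=> ca cb; apply/ler_addgt0Pr => e e0; have e2 : 0 < e / 2 by rewrite divr_gt0.
have [a' Da' aa'] := (closure_normP D a).1 ca _ e2.
have [b' Db' bb'] := (closure_normP D b).1 cb _ e2.
have := dist_le_diam Da' Db'; have := ler_distD a' a b.
have := ler_distD b' a' b; rewrite (distrC b'); lra.
Qed.

(** If D' were unbounded, the point at infinity would have a preimage in the closure of D. That
    preimage is finite because D is bounded, but finite points of the closure have finite images. *)
Lemma image_bounded : bounded_set D'.
Proof.
apply/infty_closure => clinf; have [g [[_ _ surj] _ _ _]] := hf.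
have [[x|] clx fx] := surj _ clinf; last exact: (infty_closure D).2 bD clx.
have [Dx|nDx] := pselect (D x); first by rewrite -[Some x]/(fin x) fin_partE in fx.
by have [] := @boundary_value x; [split => //; exact/closure_fin|rewrite fx].
Qed.

(** The segment from u to v is prolonged at both ends to boundary points of D', which are the images
    of boundary points of D and so at most L times the diameter of D apart. *)
Lemma image_dist_le u v : D' u -> D' v -> `|u - v| <= L * delta.
Proof.
move=> D'u D'v; have [M M0 HM] := (norm_bounded D').1 image_bounded.
have dM x y : D' x -> D' y -> `|x - y| <= M + M.
  by move=> D'x D'y; apply: le_trans (ler_normB _ _) _; apply: lerD; exact: HM.
have delta0 : 0 <= delta.
  by have [[x Dx] _ _] := uD.1.1; apply: le_trans (dist_le_diam Dx Dx).
have [->|uv] := eqVneq u v.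
  by rewrite subrr normr0 mulr_ge0// (le_trans ler01).
have [|t t0 hp] := @ray_boundary _ _ _ _ u (u - v) oD' dM D'u; first by rewrite subr_eq0.
have [|s s0 hq] := @ray_boundary _ _ _ _ v (v - u) oD' dM D'v.
  by rewrite subr_eq0 eq_sym.
have [a ba fa] := boundary_surj hp; have [b bb fb] := boundary_surj hq.
have [_] := boundary_lipschitz ba bb; rewrite /fin_part fa fb.
have -> : u + t *: (u - v) - (v + s *: (v - u)) = (1 + t + s) *: (u - v).
  rewrite -(opprB u v) scalerN opprD opprK addrACA -addrA addrA.
  by rewrite !scalerDl scale1r addrA.
have ab := boundary_dist_le_diam ba.1 bb.1.
rewrite normrZ ger0_norm ?addr_ge0// => hL.
apply: (@le_trans _ _ ((1 + t + s) * `|u - v|)).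
  by rewrite ler_peMl//; lra.
by apply: (le_trans hL); rewrite ler_wpM2l// (le_trans ler01).
Qed.

Lemma boundary_near a : closure D a /\ ~ D a -> forall e : R, 0 < e ->
  exists2 d : R, 0 < d & forall x, D x -> `|a - x| < d -> `|h a - h x| < e.
Proof.
move=> ba; have [g [_ cf _ _]] := hf.
apply: (ext_continuous_near cf); first exact/closure_fin/ba.1.
  exact: (boundary_value ba).1.
move=> x Dx; split; last exact: fin_partE.
by apply/closure_fin/subset_closure.
Qed.

Lemma fin_part_boundary_lower : boundary_lower L D h.
Proof.
apply: near_boundary_lower boundary_near _ => a b ba bb.
exact: (boundary_lipschitz ba bb).1.
Qed.

(** The lower bound for the inverse on the boundary is the upper Lipschitz bound for f; boundary
    values are approached from inside by the continuity of the inverse on the whole closure. *)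
Lemma inverse_boundary_lower g : mutually_inverse D D' h g ->
  boundary_lower L D' g.
Proof.
move=> [hg gh]; have [k [_ _ ck kf]] := hf.
have kfin x : closure D x -> k (f (fin x)) = fin x.
  by move=> cx; apply: kf; rewrite inE; exact/closure_fin.
have bv p : closure D' p /\ ~ D' p ->
    [/\ k (fin p) = fin (fin_part k p),
        closure D (fin_part k p) /\ ~ D (fin_part k p) & h (fin_part k p) = p].
  move=> bp; have [a ba fa] := boundary_surj bp.
  have ka : k (fin p) = fin a by rewrite -fa kfin//; exact: ba.1.
  by rewrite /fin_part ka fa.
apply: (near_boundary_lower (bv := fin_part k)) => [p bp|p q bp bq].
  have [kp _ _] := bv p bp.
  apply: (ext_continuous_near ck) => //; first exact/closure_fin/bp.1.
  move=> u D'u; split; first by apply/closure_fin/subset_closure.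
  have [Dgu hgu] := gh u D'u; rewrite -[in LHS]hgu -fin_partE// kfin//.
  exact: subset_closure.
have [_ ba ha] := bv p bp; have [_ bb hb] := bv q bq.
have [_] := boundary_lipschitz ba bb; rewrite ha hb.
by rewrite ler_pdivrMr ?(lt_le_trans ltr01)// mulrC.
Qed.

Lemma diam_gt0 : 0 < delta.
Proof.
have [[x Dx] _ _] := uD.1.1; have [r r0 Hr] := open_ballP oD Dx.
have [y yx xy] := punctured_ball_arbitrarily_small x dimE r0.
apply: lt_le_trans (dist_le_diam Dx (Hr y xy)).
by rewrite normr_gt0 subr_eq0 eq_sym.
Qed.

Lemma diam_attained : exists x y, [/\ D x, D y & delta / 2 <= `|x - y|].
Proof.
have [[x Dx] _ _] := uD.1.1; have d0 := diam_gt0.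
have hs : has_sup [set `|x - y| | x in D & y in D].
  split; first by exists `|x - x|, x => //; exists x.
  by exists delta => _ [a Da [b Db <-]]; exact: dist_le_diam.
have d2 : 0 < delta / 2 by rewrite divr_gt0.
have [_ [a Da [b Db <-]] ab] := sup_adherent d2 hs.
exists a, b; split => //; rewrite -/(diam D) diamD in ab; lra.
Qed.

(** Two boundary points of D at distance k have images at distance at least k / L, and half of this
    survives when they are approximated from inside. This bounds the diameter of D' from below. *)
Lemma image_spread (k : R) z : D z -> 0 < k -> k <= bdist D z ->
  exists u v, [/\ D' u, D' v & k / (2 * L) <= `|u - v|].
Proof.
move=> Dz k0 kz; have L0 := L1.
have [a [b [ba bb ab _ _]]] := far_boundary_points 0 dimE uD.1 dist_le_diam Dz k0 kz.
have e0 : 0 < k / (2 * L) by rewrite divr_gt0//; lra.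
have [a' [b' [Da' Db' _ _ hab]]] := fin_part_boundary_lower ba bb e0.
have D'h x : D x -> D' (h x).
  move=> Dx; have : (f @` (fin @` D)) (f (fin x)) by exists (fin x) => //; exists x.
  by rewrite fDE fin_partE// => -[u D'u [<-]].
exists (h a'), (h b'); split; [exact: D'h..|].
apply: le_trans hab; have h1 : k / L <= `|a - b| / L.
  by rewrite ler_pM2r// invr_gt0; lra.
have e1 : k / L = 2 * (k / (2 * L)) by field; rewrite gt_eqF//; lra.
lra.
Qed.

End main.

Theorem theorem1p3 (R : realType) (c L delta : R) (phi : R -> R)
    (hL : 1 <= L)
    (hphi : homeo (`[0, +oo[ : set R) (`[0, +oo[ : set R) phi)
    (hphi_ge : forall t : R, 0 <= t -> t <= phi t) :
  exists C alpha : R,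
    [/\ 1 <= C, 0 < alpha < 1 &
      forall (E E' : completeNormedModType R) (D : set E) (D' : set E')
        (f : ext_space E -> ext_space E'),
        dim_ge2 E -> dim_ge2 E' ->
        uniform_domain c D -> uniform_domain c D' ->
        homeo (closure (fin @` D)) (closure (fin @` D')) f ->
        f @` (fin @` D) = fin @` D' ->
        FQC phi D D' (fin_part f) ->
        boundary_bilipschitz L D D' f ->
        bounded_set D -> diam D = delta ->
        forall x y : E, D x -> D y ->
          `|x - y| `^ alpha^-1 / C <= `|fin_part f x - fin_part f y| /\
          `|fin_part f x - fin_part f y| <= C * `|x - y| `^ alpha].
Proof.
(* A domain has positive diameter, so this case is vacuous. *)
have [d0|d0] := leP delta 0.
  exists 1, 2^-1; split => //; first by apply/andP; split; lra.
  move=> E E' D D' f dimE _ uD _ _ _ _ _ bD dD.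
  by have := diam_gt0 dimE uD bD dD; rewrite ltNge d0.
have [tau [C0 [N [/andP[tau0 tau4] C00 N0 loc]]]] := local_holder hphi hphi_ge.
have [M M1 HM] := distortion_bounded hphi hphi_ge.
pose c' := Num.max 1 c; have c'1 : 1 <= c' by rewrite le_max lexx.
have cc' : c <= c' by rewrite le_max lexx orbT.
pose Delta := L * delta; have Delta0 : 0 < Delta by rewrite mulr_gt0//; lra.
pose kap := core_radius c' (delta / 2).
have d2 : 0 < delta / 2 by rewrite divr_gt0.
have kap0 : 0 < kap := core_radius_gt0 c'1 M1 d2.
pose m := Num.min (delta / 2) (kap / (2 * L)).
have m0 : 0 < m by rewrite lt_min d2 divr_gt0//; lra.
have lam1 : 1 < 1 + (4 * (1 + 2 * c'))^-1 by rewrite ltrDl invr_gt0; lra.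
have [B1 HB1] := expr_gt_exists M lam1.
(* Large enough for [MB], at least N for the change of exponent in [core_holder], and at least 2 so
   that the exponent 1 / B is less than 1. *)
pose B := (B1 + N).+2.
have MB : M <= (1 + (4 * (1 + 2 * c'))^-1) ^+ B.
  by apply: (le_trans (ltW HB1)); rewrite ler_eXn2l// /B -addnS -addnS leq_addr.
have NB : (N <= B)%N by rewrite /B -!addSn leq_addl.
have tau1 : tau <= 1 by lra.
have [C C1 HC] := core_holder c'1 M1 Delta0 m0 hL MB (ltn0Sn _) C0 tau0 tau1 N0 NB.
have B0 : 0 < B%:R :> R by rewrite ltr0n.
(* The lower bound comes from the estimate for the inverse raised to the power [B], which turns its
   constant into C^B; this also dominates C. *)
exists (C ^+ B), B%:R^-1; split; first exact: exprn_ege1.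
  by rewrite invr_gt0 B0 invf_lt1// ltr1n.
move=> E E' D D' f dimE dimE' uD uD' hf fDE fqc bf bD dD.
have uDc := uniform_domain_mono cc' uD; have uDc' := uniform_domain_mono cc' uD'.
have [domD domD' [g hg] _] := fqc; have [_ ch cg _] := hg.
have fg := homeo_inv_mutually_inverse hg; have gf : mutually_inverse D' D g (fin_part f).
  by case: fg.
have oD : open D by case: domD. have oD' : open D' by case: domD'.
have FQ := FQC_steps fg fqc; have FQ' := FQ_steps_inv fg oD oD' ch cg FQ.
have [q q'] := FQ_steps_quarter M1 HM fg domD FQ.
have dDelta : delta <= Delta by rewrite ler_peMl// ltW.
have coreD : core_domain c' Delta m D.
  split=> // [x y Dx Dy|]; first exact: le_trans (dist_le_diam bD dD Dx Dy) dDelta.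
  have [x [y [Dx Dy xy]]] := diam_attained dimE uD bD dD.
  by exists x, y; split => //; rewrite ge_min xy.
have coreD' : core_domain c' Delta m D'.
  split=> // [u v D'u D'v|].
    exact: (image_dist_le uD uD' hf fDE bf bD dD hL D'u D'v).
  have [x [y [Dx Dy xy]]] := diam_attained dimE uD bD dD.
  have [z Dz hz] := uniform_center uDc Dx Dy.
  have kz : kap <= bdist D z.
    by rewrite /kap /core_radius ler_pdivrMr; [rewrite [leRHS]mulrC (le_trans xy)|lra].
  have [u [v [D'u D'v uv]]] :=
    image_spread dimE uD uD' hf fDE bf bD dD hL Dz kap0 kz.
  by exists u, v; split => //; rewrite ge_min uv orbT.
have up := HC E E' D D' (fin_part f) g dimE coreD coreD' fg q q'
  (fin_part_boundary_lower uD uD' hf fDE bf)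
  (loc E E' D D' (fin_part f) g dimE dimE' domD fg FQ).
have low := HC E' E D' D g (fin_part f) dimE' coreD' coreD gf q' q
  (inverse_boundary_lower uD uD' hf fDE bf hL fg)
  (loc E' E D' D g (fin_part f) dimE' dimE domD' gf FQ').
move=> x y Dx Dy; split; last first.
  apply: le_trans (up x y Dx Dy) _; rewrite ler_wpM2r ?powR_ge0//.
  by rewrite -[leLHS]expr1 ler_weXn2l.
have [D'x gx] := fg.1 x Dx; have [D'y gy] := fg.1 y Dy.
have := low _ _ D'x D'y; rewrite gx gy => hxy.
rewrite invrK powR_mulrn// ler_pdivrMr ?exprn_gt0 ?(lt_le_trans ltr01)//.
apply: (@le_trans _ _ ((C * `|fin_part f x - fin_part f y| `^ B%:R^-1) ^+ B)).
  by apply: lerXn2r; rewrite ?nnegrE// mulr_ge0 ?powR_ge0// (le_trans ler01).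
by rewrite exprMn root_pow// mulrC.
Qed.
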